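(* Let $(U,\rho)$ be a simple multitype branching process with finite or countable type set $T$, root distribution $\dot\mu$ and offspring distributions $\mu^{k\to j}$ ($k,j\in T$), which is almost surely locally finite and has nonexplosive growth. For $x\in[0,1]$ and $k,j\in T$ let $\mu^{k\to j}_x=\mathrm{Bin}(\mu^{k\to j},x)$, i.e. the distribution of a random variable which, conditionally on $\xi\sim\mu^{k\to j}$, is binomial with parameters $\xi$ and $x$ (equivalently, the distribution of the number of children of type $j$ of a node of type $k$ with random label at most $x$). Then $$\iota(U,\rho)=\sum_{k\in T}y_k(1)\,\dot\mu(k),$$ where $\{y_k\}_{k\in T}$ is a solution (i.e. there exists a solution for which this identity holds), with $y_k:[0,1]\to[0,1]$, to the system of ordinary differential equations $$y_k'(x)=\sum_{\ell\in\mathbb N^T}\ \prod_{j\in T}\mu^{k\to j}_x(\ell_j)\left(1-\frac{y_j(x)}{x}\right)^{\ell_j},\qquad y_k(0)=0,\qquad k\in T.$$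
   Context: Here $\mathbb N=\{0,1,2,\dots\}$, $0^0=1$, the sum over $\ell\in\mathbb N^T$ is effectively over finitely supported $\ell$ (each node has finitely many children almost surely), and at $x=0$, where $\mu_0^{k\to j}$ is the point mass at $0$, the right-hand side is read as $1$. Multitype branching process: let $T$ be a finite or countable type set, $\dot\mu$ a distribution on $T$, and for each $k\in T$ let $(\mu^{k\to j})_{j\in T}$ be a distribution on vectors of nonnegative integers indexed by $T$. The process is the random rooted tree in which the root has a type $\tau\sim\dot\mu$, and each node of type $k$ has, for every $j\in T$, $\xi^{k\to j}$ children of type $j$, where the vector $(\xi^{k\to j})_{j\in T}$ has law $(\mu^{k\to j})_{j\in T}$; these vectors are independent for distinct nodes and independent of $\tau$. The process is called simple if for each $k$ the law $(\mu^{k\to j})_{j\in T}$ is a product measure, i.e. the numbers $\xi^{k\to j}\sim\mu^{k\to j}$, $j\in T$, are independent. The (possibly infinite) tree obtained is denoted $U$, with root $\rho$. Greedy set: a random labelling $\sigma=(\sigma_v)$ of a graph consists of i.i.d. uniform $[0,1]$ labels of the vertices (independent of the graph if it is random). The past $\mathcal P_\rho$ of $\rho$ is the set of vertices reachable from $\rho$ by a path along which labels are monotone decreasing (including $\rho$). $(U,\rho)$ has nonexplosive growth if $\mathcal P_\rho$ is almost surely finite. For a finite graph $G$, $\mathbf I_\sigma(G)$ is the set obtained by considering the vertices in increasing order of label and adding the current vertex iff it is not adjacent to any previously added vertex. Finally $\iota(U,\rho)=\mathbb P[\rho\in\mathbf I_\sigma(U[\mathcal P_\rho])]$.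
   Formalization: The formal theorem additionally assumes that a node of any type which almost surely never occurs in U would have finitely many children almost surely; without this the equation for such a type forces y_k'(0)=1 and y_k'(x)=0 for 0<x<1, which has no solution. *)

(* Defs.v *)
From HB Require Import structures.
From mathcomp Require Export all_boot all_order all_algebra finmap.
From mathcomp Require Export all_classical all_reals all_analysis.
From mathcomp Require Export summability.

Set Implicit Arguments.
Unset Strict Implicit.
Unset Printing Implicit Defensive.

Import Order.TTheory GRing.Theory Num.Theory.
Import numFieldNormedType.Exports.

Local Open Scope classical_set_scope.
Local Open Scope ring_scope.

Section independence.
Context d (Omega : measurableType d) (R : realType) (P : probability Omega R).

(* Independence of a family of sigma-algebras: F i is the set of the events of
   the i-th one. *)
Definition mutually_independent (I : choiceType) (F : I -> set (set Omega)) :=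
  forall (J : {fset I}) (A : I -> set Omega),
    (forall i, i \in J -> F i (A i)) ->
    P (\bigcap_(i in [set` J]) A i) = (\prod_(i <- J) P (A i))%E.

End independence.

(* A graph is given by a set G of vertices of an ambient type V and by an
   adjacency relation e on V, of which only the restriction to G matters. *)
Section graphs.
Context (R : realType) (V : choiceType) (e : rel V).

Definition locally_finite (G : set V) :=
  forall v, G v -> finite_set [set u | G u /\ e v u].

Definition past (s : V -> R) (G : set V) (r : V) : set V :=
  [set v | exists p : seq V,
     [/\ path (fun a b => e a b && (s b < s a)) r p,
         forall a, a \in r :: p -> G a & last r p = v]].

(* Ties between labels are broken by the order of G; they have probability 0
   for a random labelling. *)
Definition greedy_set (s : V -> R) (G : {fset V}) : seq V :=
  foldl (fun I v => if has (e v) I then I else v :: I) [::]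
        (sort (fun u v => s u <= s v) G).

End graphs.

Section offspring_laws.
Context (R : realType) (T : countType).

(* Vectors of nonnegative integers indexed by T, with the product
   sigma-algebra. *)
Definition cylinders : set (set (T -> nat)) :=
  [set C | exists (j : T) (B : set nat), C = [set l | B (l j)]].

Definition offspring := g_sigma_algebraType cylinders.

Definition simple (mu : T -> probability offspring R) :=
  forall k, mutually_independent (mu k)
    (fun j : T => preimage_set_system setT (fun l : offspring => l j) setT).

Definition marginal (mu : T -> probability offspring R) (k j : T) (n : nat) : R :=
  fine (mu k [set l | l j = n]).

(* Bin(p, x) *)
Definition thinning (p : nat -> R) (x : R) (n : nat) : R :=
  limn (series (fun m => p m * binomial_pmf m x n)).

End offspring_laws.

(* Ulam-Harris encoding: the root is [::] and (j, i) :: v is the i-th child of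
   type j of v, so that the type of a node other than the root is read off its
   head. *)
Definition node (T : countType) := seq (T * nat).

Section trees.
Context (T : countType).

Definition node_type (t : T) (v : node T) : T :=
  if v is (j, _) :: _ then j else t.

Fixpoint in_tree (t : T) (xi : node T -> T -> T -> nat) (v : node T) : bool :=
  if v is (j, i) :: u then in_tree t xi u && (i < xi u (node_type t u) j)%N
  else true.

Definition parent (u v : node T) : bool :=
  if v is _ :: u' then u' == u else false.

Definition tree_adj (u v : node T) : bool := parent u v || parent v u.

End trees.

Section branching_process.
Context d (Omega : measurableType d) (R : realType) (P : probability Omega R).
Context (T : countType).

(* tau is the type of the root and xi v k is the vector of the numbers of
   children that the node v has if its type is k; only the vectors of the nodes
   of the tree, at their actual type, are used by the tree U below. *)
Context (tau : Omega -> T) (xi : node T -> T -> {mfun Omega >-> offspring T}).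
Context (sigma : node T -> {RV P >-> R}).

Definition process_events (i : option (node T * T)) : set (set Omega) :=
  match i with
  | None => preimage_set_system setT tau setT
  | Some (v, k) => preimage_set_system setT (xi v k) measurable
  end.

(* root_law and root_measurable make mudot a probability mass function on T. *)
Record branching_process (mudot : T -> R) (mu : T -> probability (offspring T) R)
  : Prop := BranchingProcess {
  root_measurable : forall k, measurable (tau @^-1` [set k]);
  root_law : forall k, P (tau @^-1` [set k]) = (mudot k)%:E;
  offspring_law : forall v k A, measurable A -> distribution P (xi v k) A = mu k A;
  process_independent : mutually_independent P process_events }.

(* The labels are attached to all potential nodes; the sigma-algebra at index
   None is that of the whole branching process. *)
Definition labelling_events (i : option (node T)) : set (set Omega) :=
  match i with
  | None => <<s \bigcup_i process_events i >>
  | Some v => preimage_set_system setT (sigma v) measurable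
  end.

Record random_labelling : Prop := RandomLabelling {
  label_law : forall v A, measurable A ->
    distribution P (sigma v) A = uniform_prob (@ltr01 R) A;
  labelling_independent : mutually_independent P labelling_events }.

Definition U (w : Omega) : set (node T) :=
  [set v | in_tree (tau w) (fun u k => xi u k w) v].

Definition root_past (w : Omega) : set (node T) :=
  past (@tree_adj T) (fun v => sigma v w) (U w) [::].

Definition as_locally_finite :=
  {ae P, forall w, locally_finite (@tree_adj T) (U w)}.

Definition nonexplosive := {ae P, forall w, finite_set (root_past w)}.

(* Assumptions on U say nothing about such a type, whereas the system of ODEs
   has an equation for every type: if a node of such a type k had infinitely
   many children, the equation would force y_k' = 1 at 0 and y_k' = 0 on
   (0, 1]. *)
Definition never_occurs (k : T) :=
  {ae P, forall w, forall v, U w v -> node_type (tau w) v <> k}.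

(* fset_set is empty on infinite sets, so that an infinite past does not
   contribute. *)
Definition iota_root : \bar R :=
  P [set w | [::] \in greedy_set (@tree_adj T) (fun v => sigma v w)
                        (fset_set (root_past w))].

End branching_process.

Section ode.
Context (R : realType) (T : countType).

Definition derivative_within (A : set R) (f : R -> R) (x df : R) :=
  (f t - f x) / (t - x) @[t --> within A x^'] --> df.

(* Unconditional product; lim is meaningful as soon as all but finitely many
   factors are in [0, 1]. *)
Definition infprod (f : T -> R) : R :=
  lim ((fun J : {fset T} => \prod_(j <- J) f j) @ totally).

(* At x = 0 the convention y / 0 = 0 and the fact that thinning _ 0 is the
   point mass at 0 make these terms sum to 1. *)
Definition ode_term (mu : T -> probability (offspring T) R) (y : T -> R -> R)
    (k : T) (x : R) (l : {fsfun T -> nat with 0%N}) : R :=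
  infprod (fun j =>
    thinning (marginal mu k j) x (l j) * (1 - y j x / x) ^+ l j).

Record ode_solution (mu : T -> probability (offspring T) R) (y : T -> R -> R)
  : Prop := OdeSolution {
  ode_range : forall k x, 0 <= x <= 1 -> 0 <= y k x <= 1;
  ode_init : forall k, y k 0 = 0;
  ode_eq : forall k x, 0 <= x <= 1 -> exists2 dy : R,
    derivative_within `[0, 1] (y k) x dy &
    partial_sum (ode_term mu y k x) @ totally --> dy }.

End ode.

(* Main.v *)
(** Round the labels down to N cells of length 1/N, and let a node be blocked
    only by children lying in a strictly smaller cell. The selection is then
    decided cell by cell, and independence of the subtrees of the children shows
    that the probability that a node of type k is selected with a label below
    m/N is exactly the m-th iterate of the Euler scheme for y_k' = g_k(y), where
    g_k(y) = E prod_j (1 - y_j)^(xi_j) is antitone in y. A limit y of the Euler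
    polygons along an ultrafilter satisfies
      (t - s) g_k(y(t)) <= y_k(t) - y_k(s) <= (t - s) g_k(y(s))   for s <= t,
    which by continuity of g_k gives the system, with y_k' = g_k(y); this works for
    every type, whether or not the process started from it is explosive. If the past
    of the root is finite and its labels are distinct, the discretized selection
    agrees with the greedy set for N large, which identifies iota. Finally, g_k(y(x))
    is the sum over l in the statement, because both sides are equal to
    prod_j E (1 - y_j(x))^(xi_j): one expands the product over the offspring vector,
    the other over the vector of the children with label at most x. *)
Require Import Defs.
Import Order.TTheory GRing.Theory Num.Theory.
Import numFieldNormedType.Exports.
From mathcomp Require Import measurable_realfun ring lra.

Set Implicit Arguments.
Unset Strict Implicit.
Unset Printing Implicit Defensive.

Local Open Scope classical_set_scope.
Local Open Scope ring_scope.

#[local] Existing Instance totally_filter.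

(** * Unconditional sums and products *)

(** Offspring numbers may have infinite mean and there may be infinitely many types, so g_k comes
    with no Lipschitz bound and y is not built by a fixed-point argument. Nor is it defined as a
    greedy selection probability, since a root of some other type might have an infinite past. With
    finitely many cells the recursion stops in every tree, because blocking always refers to a
    smaller cell. The same strictness makes the event that no selected child lies below a given cell
    a function of the offspring vector and of the subtrees of the children, so it is independent of
    the label of the node itself: hence the exact factor 1/N of an Euler step, with no error term.
    The Euler iterates increase while g_k is antitone, so the slopes decrease; this is the source of
    the two-sided bound. Everything is summed over finitely supported offspring vectors, a countable
    set. Each offspring law is carried by it: for a type that may occur, by local finiteness and
    independence, and otherwise by [hunused]. Continuity of g_k is then dominated convergence with
    these masses as weights. *)

Lemma big_fset_sub {S : Type} {idx : S} (op : Monoid.com_law idx) {I : choiceType}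
  (A B : {fset I}) (F : I -> S) : (A `<=` B)%fset ->
  \big[op/idx]_(i <- B) F i =
  op (\big[op/idx]_(i <- A) F i) (\big[op/idx]_(i <- (B `\` A)%fset) F i).
Proof.
move=> AB; rewrite (big_fsetID _ (mem A)) /=; congr (op _ _).
  congr (bigop.body idx (enum_fset _) _); apply/fsetP => i.
  by rewrite !inE /= andb_idl// => /(fsubsetP AB).
congr (bigop.body idx (enum_fset _) _); apply/fsetP => i.
by rewrite !inE /= andbC.
Qed.

Section sums.
Context {R : realType} {I : choiceType}.
Implicit Types (f : I -> R) (X : {fset I}).

Lemma fsum_le_esum f X :
  ((\sum_(i <- X) f i)%:E <= \esum_(i in [set: I]) (f i)%:E)%E.
Proof.
apply: ereal_sup_ubound; exists [set` X].
  by split; [exact: finite_fset|].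
by rewrite fsbig_finite ?finite_fset// set_fsetK sumEFin.
Qed.

Lemma esum_le f (s : R) : (forall X, \sum_(i <- X) f i <= s) ->
  (\esum_(i in [set: I]) (f i)%:E <= s%:E)%E.
Proof.
move=> h; apply: ge_ereal_sup => /= _ [A [finA _] <-].
by rewrite fsbig_finite//= sumEFin lee_fin.
Qed.

(** [esum] is a supremum of finite partial sums, so this is the unconditional sum for nonnegative
    families, and estimates reduce to finite sets. *)
Definition has_sum f (s : R) := \esum_(i in [set: I]) (f i)%:E = s%:E.

Lemma has_sum_ub f s X : has_sum f s -> \sum_(i <- X) f i <= s.
Proof. by move=> h; rewrite -lee_fin -h fsum_le_esum. Qed.

Lemma has_sum_lb f s e : has_sum f s -> 0 < e ->
  exists X, s - e < \sum_(i <- X) f i.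
Proof.
move=> h e0; apply/not_existsP => hX.
have : (\esum_(i in [set: I]) (f i)%:E <= (s - e)%:E)%E.
  by apply: esum_le => X; rewrite leNgt; exact/negP.
by rewrite h lee_fin; lra.
Qed.

Lemma has_sumI f s : (forall X, \sum_(i <- X) f i <= s) ->
  (forall e, 0 < e -> exists X, s - e <= \sum_(i <- X) f i) -> has_sum f s.
Proof.
move=> h1 h2; apply/eqP; rewrite eq_le esum_le//=.
apply/lee_addgt0Pr => e e0.
have [X hX] := h2 _ e0; rewrite -leeBlDr//.
by apply: le_trans (fsum_le_esum f X); rewrite lee_fin.
Qed.

Lemma has_sum_bounded f (M : R) : (forall i, 0 <= f i) ->
  (forall X, \sum_(i <- X) f i <= M) ->
  has_sum f (fine (\esum_(i in [set: I]) (f i)%:E)).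
Proof.
move=> f0 fM; rewrite /has_sum fineK// ge0_fin_numE;
  last by apply: esum_ge0 => i _; rewrite lee_fin.
by rewrite (le_lt_trans (esum_le fM)) ?ltry.
Qed.

Lemma has_sum_inj f s t : has_sum f s -> has_sum f t -> s = t.
Proof. by rewrite /has_sum => -> -[]. Qed.

Lemma has_sum_ge0 f s : (forall i, 0 <= f i) -> has_sum f s -> 0 <= s.
Proof. by move=> f0 h; rewrite -lee_fin -h esum_ge0 => [|i _]; rewrite ?lee_fin. Qed.

Lemma fsum_le_subset f X Y : (forall i, 0 <= f i) -> (X `<=` Y)%fset ->
  \sum_(i <- X) f i <= \sum_(i <- Y) f i.
Proof.
move=> f0 XY; rewrite [leRHS](big_fset_sub _ _ XY) /=.
by rewrite lerDl sumr_ge0.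
Qed.

Lemma has_sum_partial_sum f s : (forall i, 0 <= f i) -> has_sum f s ->
  partial_sum f @ totally --> s.
Proof.
move=> f0 h; apply/cvgrPdist_lt => e e0.
have [X hX] := has_sum_lb h e0.
exists X => // Y /= XY; rewrite /partial_sum -(big_seq_fsetE _ Y xpredT f) /=.
have h1 := fsum_le_subset f0 XY; have h2 := has_sum_ub Y h.
by rewrite ger0_norm; lra.
Qed.

Lemma has_sum_le f g s t : (forall i, f i <= g i) -> has_sum f s ->
  has_sum g t -> s <= t.
Proof.
move=> fg hf hg; rewrite -lee_fin -hf -hg; apply: le_esum => i _.
by rewrite lee_fin.
Qed.

End sums.

Lemma fset_iota_sum {R : realType} (g : nat -> R) n :
  \sum_(i <- [fset i in iota 0 n]%fset) g i = \sum_(i < n) g i.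
Proof.
rewrite -(big_mkord xpredT g) /index_iota subn0; apply: perm_big.
by rewrite uniq_perm ?iota_uniq ?fset_uniq// => i; rewrite !inE.
Qed.

Lemma has_sum_series {R : realType} (g : nat -> R) s : (forall n, 0 <= g n) ->
  has_sum g s -> \sum_(i < n) g i @[n --> \oo] --> s.
Proof.
move=> g0 gs; apply/cvgrPdist_lt => e e0.
have [X hX] := has_sum_lb gs e0.
(* The sum of the elements of [X] bounds each of them, so the initial segment contains [X]. *)
exists (\sum_(i <- X) i).+1 => // n /= Xn; rewrite -fset_iota_sum.
have h1 := has_sum_ub [fset i in iota 0 n]%fset gs.
have h2 : \sum_(i <- X) g i <= \sum_(i <- [fset i in iota 0 n]%fset) g i.
  apply: fsum_le_subset => //; apply/fsubsetP => i iX; rewrite !inE mem_iota /=.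
  by rewrite add0n; apply: leq_trans Xn; rewrite ltnS (big_rem i)//= leq_addr.
by rewrite ger0_norm; lra.
Qed.

(** Dominated convergence for series with weights [p]: outside a finite set [J] carrying all but e/3
    of the mass of [p], the sums are at most e/3 uniformly in [x]. The filter is arbitrary because
    it will be an ultrafilter on the number of cells as well as a punctured neighbourhood in
    [0, 1]. *)
Lemma has_sum_cvg {R : realType} {I : choiceType} {X : Type} (F : set_system X)
  {FF : Filter F} (p : I -> R) (P : R) (u : X -> I -> R) (v : I -> R)
  (s : X -> R) (t : R) : (forall i, 0 <= p i) -> has_sum p P ->
  (\forall x \near F, forall i, 0 <= u x i <= 1) -> (forall i, 0 <= v i <= 1) ->
  (forall i, u x i @[x --> F] --> v i) ->
  (\forall x \near F, has_sum (fun i => p i * u x i) (s x)) ->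
  has_sum (fun i => p i * v i) t ->
  s x @[x --> F] --> t.
Proof.
move=> p0 hp hu hv uv hs ht; apply/cvgrPdist_le => e e0.
have e3 : 0 < e / 3 by lra.
have [J hJ] := has_sum_lb hp e3.
have key w r : (forall i, 0 <= w i <= 1) -> has_sum (fun i => p i * w i) r ->
    0 <= r - \sum_(i <- J) p i * w i <= e / 3.
  move=> hw hr; rewrite subr_ge0 has_sum_ub//= lerBlDr.
  rewrite -lee_fin -hr; apply: esum_le => Y.
  have : \sum_(i <- (J `|` Y)%fset) p i <= P by exact: has_sum_ub.
  rewrite (big_fset_sub _ _ (fsubsetUl J Y)) /= => hJY.
  apply: (@le_trans _ _ (\sum_(i <- (J `|` Y)%fset) p i * w i)).
    apply: fsum_le_subset; rewrite ?fsubsetUr// => i.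
    by rewrite mulr_ge0//; case/andP: (hw i).
  rewrite (big_fset_sub _ _ (fsubsetUl J Y)) /= addrC lerD2r.
  apply: (@le_trans _ _ (\sum_(i <- ((J `|` Y) `\` J)%fset) p i)).
    by apply: ler_sum => i _; rewrite ler_piMr//; case/andP: (hw i).
  lra.
have hJc : \sum_(i <- J) p i * u x i @[x --> F] --> \sum_(i <- J) p i * v i.
  apply: cvg_big => [|i _]; first exact: add_continuous.
  by apply: cvgM; [exact: cvg_cst|exact: uv].
have {hJc} /cvgrPdist_le /(_ _ e3) hJc := hJc.
have htJ := key _ _ hv ht.
near=> x.
have hx : forall i, 0 <= u x i <= 1 by near: x.
have hsx : has_sum (fun i => p i * u x i) (s x) by near: x.
have hsJ := key _ _ hx hsx.
have : `|\sum_(i <- J) p i * v i - \sum_(i <- J) p i * u x i| <= e / 3 by near: x.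
rewrite !ler_norml; lra.
Unshelve. all: by end_near.
Qed.

Section infinite_products.
Context {R : realType} {T : countType}.
Implicit Types (f : T -> R) (J : {fset T}).

Lemma fprod_le_subset f J K : (forall j, 0 <= f j <= 1) -> (J `<=` K)%fset ->
  \prod_(j <- K) f j <= \prod_(j <- J) f j.
Proof.
move=> f01 JK; rewrite (big_fset_sub _ _ JK) /=.
rewrite ler_piMr ?prodr_ge0// => [i _|]; first by case/andP: (f01 i).
by apply: prodr_ile1 => i _; exact: f01.
Qed.

(** Finite products of factors in [0, 1] decrease as the index set grows, so they converge to their
    infimum. *)
Lemma infprod_cvg f : (forall j, 0 <= f j <= 1) ->
  (fun J => \prod_(j <- J) f j) @ totally --> infprod f.
Proof.
move=> f01; suff h : (fun J => \prod_(j <- J) f j) @ totally -->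
    inf [set \prod_(j <- J) f j | J in [set: {fset T}]].
  by apply/cvg_ex; exists (inf [set \prod_(j <- J) f j | J in [set: {fset T}]]).
set S := [set _ | J in _].
have hS : has_inf S.
  split; first by exists (\prod_(j <- fset0) f j), fset0.
  by exists 0 => _ [J _ <-]; apply: prodr_ge0 => j _; case/andP: (f01 j).
apply/cvgrPdist_lt => e e0.
have [_ [J _ <-] hJ] := inf_adherent e0 hS.
exists J => // K /= JK.
have h1 : inf S <= \prod_(j <- K) f j by apply: ge_inf; [case: hS|exists K].
have h2 := fprod_le_subset f01 JK.
rewrite ler0_norm; lra.
Qed.

Lemma infprod_le f J : (forall j, 0 <= f j <= 1) ->
  infprod f <= \prod_(j <- J) f j.
Proof.
move=> f01; apply: (cvgr_to_le (infprod_cvg f01)).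
by exists J => // K /= JK; exact: fprod_le_subset.
Qed.

Lemma infprod_ge f J0 (c : R) : (forall j, 0 <= f j <= 1) ->
  (forall J, (J0 `<=` J)%fset -> c <= \prod_(j <- J) f j) -> c <= infprod f.
Proof.
by move=> f01 h; apply: (cvgr_to_ge (infprod_cvg f01)); exists J0.
Qed.

Lemma infprod_itv f : (forall j, 0 <= f j <= 1) -> 0 <= infprod f <= 1.
Proof.
move=> f01; rewrite (@infprod_ge _ fset0)//= => [|J _].
  by rewrite (le_trans (infprod_le fset0 f01))// big_seq_fset0.
by apply: prodr_ge0 => j _; case/andP: (f01 j).
Qed.

End infinite_products.

Section product_of_sums.
Context {R : realType} {T : countType}.
Local Notation fsvec := {fsfun T -> nat with 0%N}.
Implicit Types (a : T -> nat -> R) (J : {fset T}) (l : fsvec).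

(** Distributivity of product over sum, transported from finite functions on [J] to finitely
    supported vectors. *)
Lemma box_sum a J n : exists2 B : {fset fsvec},
  forall l, (l \in B) = (finsupp l `<=` J)%fset && all (fun j => l j < n)%N J &
  \sum_(l <- B) \prod_(j <- J) a j (l j) = \prod_(j <- J) \sum_(i < n) a j i.
Proof.
pose ext (f : {ffun J -> 'I_n}) : fsvec := [fsfun j : J => nat_of_ord (f j)].
have extE f (j : J) : ext f (val j) = f j.
  by rewrite /ext fsfun_ffun valK.
exists [fset ext f | f in {ffun J -> 'I_n}]%fset.
  move=> l; apply/imfsetP/andP => /= [[f _ ->]|[lJ /allP ln]].
    split; first exact: finsupp_sub.
    apply/allP => j jJ; rewrite (extE f [` jJ]%fset); exact: ltn_ord.
  have ln' (j : J) : (l (val j) < n)%N by apply: ln; exact: valP.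
  exists [ffun j => Ordinal (ln' j)] => //; apply/fsfunP => j.
  case: (boolP (j \in J)) => jJ; first by rewrite (extE _ [` jJ]%fset) ffunE.
  rewrite [RHS]fsfun_dflt; last by apply: contra jJ; apply/fsubsetP/finsupp_sub.
  by rewrite fsfun_dflt//; apply: contra jJ; apply/fsubsetP.
rewrite big_imfset /=; last first.
  move=> f g _ _ fg; apply/ffunP => j; apply: val_inj => /=.
  by rewrite -!extE fg.
rewrite big_enum /= (big_seq_fsetE _ J) /= bigA_distr_bigA /=.
apply: eq_bigr => f _; rewrite (big_seq_fsetE _ J) /=.
by apply: eq_bigr => j _; rewrite extE.
Qed.

Lemma fsvec_bound (X : {fset fsvec}) :
  exists n, forall l, l \in X -> forall j, (l j < n)%N.
Proof.
exists (\sum_(l <- X) \sum_(j <- finsupp l) l j).+1 => l lX j; rewrite ltnS.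
have [jl|jl] := boolP (j \in finsupp l); last by rewrite fsfun_dflt.
by rewrite (big_rem l)//= (big_rem j)//= -addnA leq_addr.
Qed.

(* Without the condition on the tails of [\prod_j a j 0], mass could escape to the
   vectors of infinite support. *)
Lemma has_sum_infprod a (A : T -> R) : (forall j n, 0 <= a j n) ->
  (forall j, has_sum (a j) (A j)) -> (forall j, A j <= 1) ->
  (forall e, 0 < e -> exists J0 : {fset T}, forall J : {fset T},
     [disjoint J0 & J]%fset -> 1 - e <= \prod_(j <- J) a j 0%N) ->
  has_sum (fun l : fsvec => infprod (fun j => a j (l j))) (infprod A).
Proof.
move=> a0 aA A1 tail.
have aA' j n : a j n <= A j.
  by have := has_sum_ub [fset n]%fset (aA j); rewrite big_seq_fset1.
have a01 j n : 0 <= a j n <= 1 by rewrite a0 (le_trans (aA' _ _) (A1 _)).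
have A0 j : 0 <= A j by exact: le_trans (a0 j 0%N) (aA' _ _).
have A01 j : 0 <= A j <= 1 by rewrite A0 A1.
have partA j n : \sum_(i < n) a j i <= A j.
  by have := has_sum_ub [fset i in iota 0 n]%fset (aA j); rewrite fset_iota_sum.
apply: has_sumI => [X|e e0].
  have [n Xn] := fsvec_bound X.
  apply: (@infprod_ge _ _ _ (\bigcup_(l <- X) finsupp l)%fset) => // J XJ.
  have [B BE Bsum] := box_sum a J n.
  apply: (@le_trans _ _ (\prod_(j <- J) \sum_(i < n) a j i)); last first.
    by apply: ler_prod => j _; rewrite partA sumr_ge0.
  rewrite -Bsum; apply: (@le_trans _ _ (\sum_(l <- X) \prod_(j <- J) a j (l j))).
    by apply: ler_sum => l _; apply: infprod_le.
  apply: fsum_le_subset => [l|]; first by rewrite prodr_ge0.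
  apply/fsubsetP => l lX; rewrite BE; apply/andP; split.
    by apply: fsubset_trans XJ; apply: bigfcup_sup.
  by apply/allP => j _; exact: Xn.
(* Half of [e] pays for truncating the sums over [J0] to [n] terms, the other half for the factors
   outside [J0], which are all [a j 0] for vectors supported in [J0]. *)
have [J0 hJ0] := tail _ (divr_gt0 e0 (ltr0Sn R 1)).
have : \prod_(j <- J0) \sum_(i < n) a j i @[n --> \oo] --> \prod_(j <- J0) A j.
  apply: cvg_big => [|j _]; first exact: mul_continuous.
  exact: has_sum_series.
move=> /cvgrPdist_le /(_ _ (divr_gt0 e0 (ltr0Sn R 1))) [n _ /(_ n (leqnn n)) /=].
move=> hn; have [B BE Bsum] := box_sum a J0 n; exists B.
have lA := infprod_le J0 A01.
have pa0 : 0 <= \prod_(j <- J0) \sum_(i < n) a j i <= 1.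
  rewrite prodr_ge0/= => [|j _]; last by rewrite sumr_ge0.
  by apply: prodr_ile1 => j _; rewrite sumr_ge0//= (le_trans (partA _ _)).
apply: (@le_trans _ _ ((1 - e / 2) * \prod_(j <- J0) \sum_(i < n) a j i)).
  by move: hn; rewrite ler_norml => /andP[_ hn]; nra.
rewrite -Bsum mulr_sumr big_seq [leRHS]big_seq.
apply: ler_sum => l; rewrite BE => /andP[lJ _].
apply: (@infprod_ge _ _ _ J0) => // J J0J.
rewrite (big_fset_sub _ _ J0J) /= mulrC ler_wpM2l ?prodr_ge0//.
rewrite [leRHS](_ : _ = \prod_(j <- (J `\` J0)%fset) a j 0%N).
  by apply: hJ0; apply/fdisjointP => j jJ0; rewrite !inE jJ0.
rewrite big_seq [RHS]big_seq; apply: eq_bigr => j; rewrite !inE => /andP[jJ0 _].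
by rewrite fsfun_dflt//; apply: contra jJ0; apply/fsubsetP.
Qed.

End product_of_sums.

(** * Thinning and generating functions *)

Lemma has_sum_scale {R : realType} {I : choiceType} (f : I -> R) s c :
  0 <= c -> has_sum f s -> has_sum (fun i => c * f i) (c * s).
Proof.
move=> c0 fs; apply: has_sumI => [X|e e0].
  by rewrite -mulr_sumr ler_wpM2l// has_sum_ub.
have c1 : 0 < c + 1 by lra.
have [X hX] := has_sum_lb fs (divr_gt0 e0 c1); exists X.
rewrite -mulr_sumr.
have : c * (e / (c + 1)) <= e by rewrite mulrA ler_pdivrMr//; nra.
by nra.
Qed.

Lemma has_sum_finite {R : realType} (f : nat -> R) n :
  (forall i, 0 <= f i) -> (forall i, (n <= i)%N -> f i = 0) ->
  has_sum f (\sum_(i < n) f i).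
Proof.
move=> f0 fn; rewrite -fset_iota_sum; apply: has_sumI => [X|e e0]; last first.
  by exists [fset i in iota 0 n]%fset; lra.
rewrite (big_fset_sub _ _ (fsubsetIl X [fset i in iota 0 n]%fset)) /=.
rewrite [X in _ + X]big1_seq ?addr0.
  by apply: fsum_le_subset => //; exact: fsubsetIr.
move=> i /andP[_]; rewrite !inE mem_iota /= add0n negb_and => /andP[+ iX].
by rewrite iX /= -leqNgt; exact: fn.
Qed.

Section thinning.
Context {R : realType} (p : nat -> R) (P x : R).
Hypotheses (p0 : forall n, 0 <= p n) (hp : has_sum p P) (x01 : 0 <= x <= 1).

Lemma binomial_pmf_nneg m n : 0 <= binomial_pmf m x n.
Proof. exact: binomial_pmf_ge0. Qed.

Lemma binomial_pmf_gen m (z : R) : 0 <= z ->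
  has_sum (fun n => binomial_pmf m x n * z ^+ n) ((1 - x + x * z) ^+ m).
Proof.
move=> z0; rewrite exprDn.
rewrite [X in has_sum _ X](_ : _ = \sum_(i < m.+1) binomial_pmf m x i * z ^+ i).
  apply: has_sum_finite => n; first by rewrite mulr_ge0 ?exprn_ge0 ?binomial_pmf_nneg.
  by move=> mn; rewrite /binomial_pmf bin_small// mulr0n mul0r.
apply: eq_bigr => i _; rewrite /binomial_pmf exprMn -mulr_natr -[in RHS]mulr_natr; ring.
Qed.

Lemma has_sum_thinning n :
  has_sum (fun m => p m * binomial_pmf m x n) (thinning p x n).
Proof.
have b1 m : binomial_pmf m x n <= 1.
  have := binomial_pmf_gen m (@ler01 R); rewrite mulr1 subrK expr1n => h.
  have := has_sum_ub [fset n]%fset h.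
  by rewrite big_seq_fset1 expr1n mulr1.
have h0 m : 0 <= p m * binomial_pmf m x n by rewrite mulr_ge0 ?binomial_pmf_nneg.
have h : has_sum (fun m => p m * binomial_pmf m x n)
    (fine (\esum_(m in [set: nat]) (p m * binomial_pmf m x n)%:E)).
  apply: (@has_sum_bounded _ _ _ P) => // X.
  apply: le_trans (has_sum_ub X hp); apply: ler_sum => m _.
  by rewrite ler_piMr.
rewrite [thinning _ _ _](_ : _ = fine (\esum_(m in [set: nat]) (p m * binomial_pmf m x n)%:E))//.
apply/cvg_lim => //; rewrite (_ : series _ = (fun k => \sum_(i < k) p i * binomial_pmf i x n)).
  exact: has_sum_series h0 h.
by apply/funext => k; rewrite /series/= big_mkord.
Qed.

Lemma thinning_ge0 n : 0 <= thinning p x n.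
Proof.
by apply: has_sum_ge0 (has_sum_thinning n) => m; rewrite mulr_ge0 ?binomial_pmf_nneg.
Qed.

(** Tonelli for a nonnegative double series: summing over [n] first gives the binomial theorem for
    each [m]. With [z = 1 - y / x] and [x] nonzero the argument [1 - x + x * z] is [1 - y], which is
    how thinning disappears from the system. *)
Lemma has_sum_thinning_gen z s : 0 <= z ->
  has_sum (fun m => p m * (1 - x + x * z) ^+ m) s ->
  has_sum (fun n => thinning p x n * z ^+ n) s.
Proof.
move=> z0; rewrite /has_sum => <-.
pose f m n := (p m * (binomial_pmf m x n * z ^+ n))%:E.
have f0 m n : (0 <= f m n)%E.
  by rewrite lee_fin !mulr_ge0 ?exprn_ge0 ?binomial_pmf_nneg.
transitivity (\esum_(n in [set: nat]) \esum_(m in [set: nat]) f m n).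
  apply: eq_esum => n _; have := has_sum_scale (exprn_ge0 n z0) (has_sum_thinning n).
  by rewrite /has_sum mulrC => <-; apply: eq_esum => m _; rewrite /f; congr EFin; ring.
transitivity (\esum_(m in [set: nat]) \esum_(n in [set: nat]) f m n).
  have := nneseries_interchange (a := fun n m => f m n) xpredT xpredT (fun n m => f0 m n).
  rewrite !nneseries_esumT => [h||]; first last.
  - by move=> n; apply: nneseries_ge0.
  - by move=> n; apply: nneseries_ge0.
  under eq_esum do rewrite -nneseries_esumT//.
  rewrite h; by under eq_esum do rewrite nneseries_esumT//.
by apply: eq_esum => m _; exact: has_sum_scale (binomial_pmf_gen m z0).
Qed.

(** The term [m = 0] alone. It carries the tail condition of [has_sum_infprod] from the marginals to
    their thinnings. *)
Lemma thinning0_ge : p 0%N <= thinning p x 0%N.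
Proof.
have := has_sum_ub [fset 0%N]%fset (has_sum_thinning 0%N).
by rewrite big_seq_fset1 /binomial_pmf subn0 !expr0 bin0 mulr1n !mulr1.
Qed.

Lemma thinning_le n : thinning p x n <= P.
Proof.
have := @has_sum_thinning_gen 1 P ler01.
rewrite mulr1 subrK; under eq_fun do rewrite expr1n mulr1.
move=> /(_ hp) h; have := has_sum_ub [fset n]%fset h.
by rewrite big_seq_fset1 expr1n mulr1.
Qed.

End thinning.

Lemma infprod_mulr {R : realType} {T : countType} (f g : T -> R) (J0 : {fset T}) :
  (forall j, 0 <= f j <= 1) -> (forall j, j \notin J0 -> g j = 1) ->
  infprod (fun j => f j * g j) = infprod f * \prod_(j <- J0) g j.
Proof.
move=> f01 g1; apply/cvg_lim => //.
have : (fun J => (\prod_(j <- J) f j) * \prod_(j <- J0) g j) @ totally -->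
    infprod f * \prod_(j <- J0) g j.
  by apply: cvgM; [exact: infprod_cvg|exact: cvg_cst].
apply: cvg_trans; apply: near_eq_cvg; exists J0 => // J /= J0J.
rewrite big_split /=; congr (_ * _); rewrite (big_fset_sub _ _ J0J) /=.
by rewrite [X in _ * X]big1_seq ?mulr1// => j /andP[_]; rewrite !inE => /andP[/g1].
Qed.

Section generating_function.
Context {R : realType} {T : countType}.
Local Notation fsvec := {fsfun T -> nat with 0%N}.

Definition fsmonomial (z : T -> R) (l : fsvec) : R :=
  \prod_(j <- finsupp l) z j ^+ l j.

(** The function g_k when [q] is the offspring law of type k: the probability that no child is
    selected if each child of type [j] is selected with probability [y j], independently. *)
Definition gen (q : fsvec -> R) (y : T -> R) : R :=
  fine (\esum_(l in [set: fsvec]) (q l * fsmonomial (fun j => 1 - y j) l)%:E).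

Lemma fsmonomial_itv (z : T -> R) (l : fsvec) :
  (forall j, 0 <= z j <= 1) -> 0 <= fsmonomial z l <= 1.
Proof.
move=> z01; have h j : 0 <= z j ^+ l j <= 1.
  by case/andP: (z01 j) => *; rewrite exprn_ge0// exprn_ile1.
rewrite /fsmonomial prodr_ge0 => [|j _]; last by case/andP: (h j).
exact: prodr_ile1.
Qed.

Variable q : fsvec -> R.
Hypotheses (q0 : forall l, 0 <= q l) (hq : has_sum q 1).
Implicit Types y : T -> R.

Let y01 y : (forall j, 0 <= y j <= 1) -> forall j, 0 <= 1 - y j <= 1.
Proof. by move=> h j; have := h j; lra. Qed.


Lemma has_sum_gen y : (forall j, 0 <= y j <= 1) ->
  has_sum (fun l => q l * fsmonomial (fun j => 1 - y j) l) (gen q y).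
Proof.
move=> hy; apply: (@has_sum_bounded _ _ _ 1) => [l|X].
  by rewrite mulr_ge0//; have /andP[] := fsmonomial_itv l (y01 hy).
apply: le_trans (has_sum_ub X hq); apply: ler_sum => l _.
by rewrite ler_piMr//; have /andP[] := fsmonomial_itv l (y01 hy).
Qed.

Lemma gen_itv y : (forall j, 0 <= y j <= 1) -> 0 <= gen q y <= 1.
Proof.
move=> hy; have h := has_sum_gen hy; apply/andP; split.
  apply: has_sum_ge0 h => l.
  by rewrite mulr_ge0//; have /andP[] := fsmonomial_itv l (y01 hy).
apply: has_sum_le h hq => l.
by rewrite ler_piMr//; have /andP[] := fsmonomial_itv l (y01 hy).
Qed.

Lemma gen_antitone y y' : (forall j, 0 <= y j <= 1) ->
  (forall j, 0 <= y' j <= 1) -> (forall j, y j <= y' j) -> gen q y' <= gen q y.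
Proof.
move=> hy hy' yy'; apply: has_sum_le (has_sum_gen hy') (has_sum_gen hy) => l.
rewrite ler_wpM2l//; apply: ler_prod => j _.
have /andP[h1 h2] := y01 hy' j.
by rewrite exprn_ge0//= lerXn2r ?nnegrE//; have := yy' j; lra.
Qed.

(** Pointwise convergence of the coordinates suffices: each monomial involves finitely many of them,
    and the masses [q] dominate. *)
Lemma gen_cvg {X : Type} (F : set_system X) {FF : Filter F} (u : X -> T -> R) y :
  (\forall x \near F, forall j, 0 <= u x j <= 1) -> (forall j, 0 <= y j <= 1) ->
  (forall j, u x j @[x --> F] --> y j) -> gen q (u x) @[x --> F] --> gen q y.
Proof.
move=> hu hy uy.
apply: (has_sum_cvg q0 hq (u := fun x => fsmonomial (fun j => 1 - u x j)) _ _ _ _ (has_sum_gen hy)).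
- by near=> x => l; apply: fsmonomial_itv; apply: y01; near: x.
- by move=> l; apply: fsmonomial_itv; exact: y01.
- move=> l; apply: cvg_big => [|j _]; first exact: mul_continuous.
  apply: (@continuous_cvg _ _ _ _ _ (fun x => 1 - u x j) (fun z => z ^+ l j)).
    exact: exprn_continuous.
  by apply: cvgB; [exact: cvg_cst|exact: uy].
- by near=> x; apply: has_sum_gen; near: x.
Unshelve. all: by end_near.
Qed.

Variable p : T -> nat -> R.
Hypotheses (p0 : forall j n, 0 <= p j n) (hp : forall j, has_sum (p j) 1).
Hypothesis qp : forall l, q l = infprod (fun j => p j (l j)).

Let p01 j n : 0 <= p j n <= 1.
Proof. by rewrite p0/=; have := has_sum_ub [fset n]%fset (hp j); rewrite big_seq_fset1. Qed.

(* Some [q l] is positive, which bounds the products of the [p j 0] off the support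
   of l away from 0. *)
Lemma tail_product e : 0 < e -> exists J0 : {fset T}, forall J : {fset T},
  [disjoint J0 & J]%fset -> 1 - e <= \prod_(j <- J) p j 0%N.
Proof.
move=> e0; have [l ql] : exists l, 0 < q l.
  apply/not_existsP => h; have : has_sum q 0.
    rewrite /has_sum esum1// => l _; congr EFin.
    by apply/eqP; rewrite eq_le q0 andbT leNgt; exact/negP.
  by move=> /(has_sum_inj hq) /eqP; rewrite oner_eq0.
pose f j := if j \in finsupp l then 1 else p j 0%N.
have f01 j : 0 <= f j <= 1 by rewrite /f; case: ifP => //; rewrite ler01 lexx.
have c0 : 0 < infprod f.
  apply: (lt_le_trans ql); apply: (@infprod_ge _ _ _ fset0) => // J _.
  rewrite qp; apply: le_trans (infprod_le J (fun j => p01 j (l j))) _.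
  apply: ler_prod => j _; rewrite p0/= /f.
  by case: finsuppP => //; case/andP: (p01 j (l j)).
(* With c = [infprod f], the product over [J1] is below c (1 + e) while that over [J1] and [J]
   together is at least c; hence the product over [J] is at least 1 / (1 + e) >= 1 - e. *)
have /cvgrPdist_lt /(_ _ (mulr_gt0 c0 e0)) [J1 _ /(_ J1 (fsubset_refl _)) /=] := infprod_cvg f01.
rewrite ltr_norml => /andP[h1 h2]; exists (finsupp l `|` J1)%fset => J JJ.
have [lJ J1J] : [disjoint finsupp l & J]%fset /\ [disjoint J1 & J]%fset.
  by move: JJ; rewrite fdisjointUX => /andP.
have -> : \prod_(j <- J) p j 0%N = \prod_(j <- J) f j.
  rewrite big_seq [RHS]big_seq; apply: eq_bigr => j jJ; rewrite /f.
  by rewrite ifN//; apply/negP; move/fdisjointP: lJ => /[apply]; rewrite jJ.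
have := infprod_le (J1 `|` J)%fset f01.
rewrite (big_fset_sub _ _ (fsubsetUl J1 J)) /=.
rewrite (_ : ((J1 `|` J) `\` J1)%fset = J); last first.
  apply/fsetP => j; rewrite !inE; case: (boolP (j \in J1)) => //= jJ1.
  by apply/esym/negbTE; move/fdisjointP: J1J; apply.
have : 0 <= \prod_(j <- J) f j by apply: prodr_ge0 => j _; case/andP: (f01 j).
nra.
Qed.

Lemma has_sum_ode_term y x : 0 <= x <= 1 -> (forall j, 0 <= y j <= x) ->
  has_sum (fun l : fsvec =>
    infprod (fun j => thinning (p j) x (l j) * (1 - y j / x) ^+ l j)) (gen q y).
Proof.
move=> x01 hyx.
have hy j : 0 <= y j <= 1 by have := hyx j; lra.
pose A j := fine (\esum_(n in [set: nat]) (p j n * (1 - y j) ^+ n)%:E).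
have pow01 j n : 0 <= (1 - y j) ^+ n <= 1.
  by have /andP[*] := y01 hy j; rewrite exprn_ge0// exprn_ile1.
have hA j : has_sum (fun n => p j n * (1 - y j) ^+ n) (A j).
  apply: (@has_sum_bounded _ _ _ 1) => [n|X].
    by rewrite mulr_ge0//; case/andP: (pow01 j n).
  apply: le_trans (has_sum_ub X (hp j)); apply: ler_sum => n _.
  by rewrite ler_piMr//; case/andP: (pow01 j n).
have A1 j : A j <= 1.
  apply: has_sum_le (hA j) (hp j) => n.
  by rewrite ler_piMr//; case/andP: (pow01 j n).
have z01 j : 0 <= 1 - y j / x <= 1.
  have [-> |xN0] := eqVneq x 0; first by rewrite invr0 mulr0 subr0 ler01 lexx.
  have xp : 0 < x by rewrite lt_neqAle eq_sym xN0; lra.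
  have := hyx j => /andP[h1 h2].
  have : y j / x <= 1 by rewrite ler_pdivrMr// mul1r.
  have : 0 <= y j / x by rewrite divr_ge0// ltW.
  lra.
suff -> : gen q y = infprod A.
  apply: (has_sum_infprod (a := fun j n => thinning (p j) x n * (1 - y j / x) ^+ n)) => //.
  - move=> j n; rewrite mulr_ge0 ?(thinning_ge0 (p0 j) (hp j))//.
    by rewrite exprn_ge0//; case/andP: (z01 j).
  - move=> j; apply: (has_sum_thinning_gen (p0 j) (hp j)) => //; first by case/andP: (z01 j).
    rewrite (_ : 1 - x + _ = 1 - y j)//.
    (* At [x = 0] the bound [y j <= x] forces [y j = 0], and both sides are 1. *)
    have [x0|xN0] := eqVneq x 0; last by field.
    by have := hyx j; rewrite x0; lra.
  - move=> e e0; have [J0 hJ0] := tail_product e0; exists J0 => J /hJ0 h.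
    apply: le_trans h _; apply: ler_prod => j _; rewrite p0 mulr1/=.
    exact: thinning0_ge (hp j) x01.
apply: (has_sum_inj (has_sum_gen hy)).
rewrite (_ : (fun l : fsvec => q l * _) =
    (fun l : fsvec => infprod (fun j => p j (l j) * (1 - y j) ^+ l j))).
  apply: (has_sum_infprod (a := fun j n => p j n * (1 - y j) ^+ n)) => //.
  - by move=> j n; rewrite mulr_ge0//; case/andP: (pow01 j n).
  - move=> e e0; have [J0 hJ0] := tail_product e0; exists J0 => J /hJ0 h.
    by under eq_bigr do rewrite expr0 mulr1.
apply/funext => l; rewrite qp (@infprod_mulr _ _ _ _ (finsupp l))//.
by move=> j jl; rewrite fsfun_dflt.
Qed.

End generating_function.

(** * The Euler scheme *)

Section euler.
Context {R : realType} {T : countType}.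
Local Notation fsvec := {fsfun T -> nat with 0%N}.
Variable q : T -> fsvec -> R.
Hypotheses (q0 : forall k l, 0 <= q k l) (hq : forall k, has_sum (q k) 1).

Section scheme.
Variable n : nat.
Let h : R := n.+1%:R^-1.
Let h0 : 0 < h. Proof. by rewrite invr_gt0. Qed.

(* [euler m k] approximates y_k at m / n.+1. *)
Fixpoint euler (m : nat) (k : T) : R :=
  if m is m'.+1 then euler m' k + h * gen (q k) (euler m') else 0.

Lemma euler_itv m k : (m <= n.+1)%N -> 0 <= euler m k <= 1.
Proof.
(* The slope [gen] is known to be at most 1 only while the iterates stay in [0, 1]; the invariant
   [m%:R * h], at most 1 up to m = n + 1, ensures this. *)
suff H : forall m, (m <= n.+1)%N -> forall k, 0 <= euler m k <= m%:R * h.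
  move=> mn; have /andP[-> /= h1] := H m mn k; apply: le_trans h1 _.
  by rewrite ler_pdivrMr// mul1r ler_nat.
elim=> [|{}m IH] mn {}k; first by rewrite mul0r lexx.
have {}IH := IH (ltnW mn).
have : 0 <= gen (q k) (euler m) <= 1.
  apply: gen_itv => // j; have /andP[-> /= h1] := IH j; apply: le_trans h1 _.
  by rewrite ler_pdivrMr// mul1r ler_nat ltnW.
have /andP[e0 e1] := IH k; rewrite /= -natr1 mulrDl mul1r => /andP[g0 g1].
rewrite addr_ge0 ?mulr_ge0 ?(ltW h0)//= lerD//.
by rewrite ler_piMr// ltW.
Qed.

(** The iterates increase and [gen] is antitone, so each slope between steps [m] and [m'] lies
    between the slopes at the two ends. The induction treats all types at once, since antitonicity
    compares all coordinates. *)
Lemma euler_bounds m m' k : (m <= m')%N -> (m' <= n.+1)%N ->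
  [/\ euler m k <= euler m' k,
   (m' - m)%:R * h * gen (q k) (euler m') <= euler m' k - euler m k &
   euler m' k - euler m k <= (m' - m)%:R * h * gen (q k) (euler m)].
Proof.
elim: m' k => [|m' IH] k.
  by rewrite leqn0 => /eqP -> _; rewrite subnn !mul0r subrr lexx.
rewrite leq_eqVlt => /orP[/eqP <- _|].
  by rewrite subnn !mul0r subrr lexx.
rewrite ltnS => mm' m'n; have {}IH j := IH j mm' (ltnW m'n).
have e01 i j : (i <= n.+1)%N -> 0 <= euler i j <= 1 by move=> *; exact: euler_itv.
have /andP[g0 g1] : 0 <= gen (q k) (euler m') <= 1.
  by apply: gen_itv => // j; apply: e01; exact: ltnW.
have gg : gen (q k) (euler m') <= gen (q k) (euler m).
  apply: gen_antitone => // [j|j|j]; last by case: (IH j).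
  - by apply: e01; rewrite (leq_trans mm')// ltnW.
  - by apply: e01; exact: ltnW.
have gS : gen (q k) (euler m'.+1) <= gen (q k) (euler m').
  apply: gen_antitone => // [j|j|j]; [by apply: e01; exact: ltnW|exact: e01|].
  rewrite /= lerDl mulr_ge0 ?(ltW h0)//.
  suff /andP[] : 0 <= gen (q j) (euler m') <= 1 by [].
  by apply: gen_itv => // i; apply: e01; exact: ltnW.
have gS0 : 0 <= gen (q k) (euler m'.+1).
  suff /andP[] : 0 <= gen (q k) (euler m'.+1) <= 1 by [].
  by apply: gen_itv => // i; apply: e01.
have [I1 I2 I3] := IH k; rewrite subSn// -natr1 /=.
have d0 : 0 <= (m' - m)%:R :> R by [].
have hd0 : 0 <= (m' - m)%:R * h by rewrite mulr_ge0// ltW.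
have p1 := ler_wpM2l hd0 gS; have p2 := ler_wpM2l (ltW h0) gS.
have p3 := ler_wpM2l (ltW h0) gg; have p4 := mulr_ge0 (ltW h0) g0.
by split; move: I1 I2 I3 p1 p2 p3 p4; rewrite /= ?mulrDl ?mul1r; lra.
Qed.

(** A step function rather than an interpolation: the iterate at the last grid point not exceeding
    [x]. *)
Definition polygon (k : T) (x : R) := euler (Num.trunc (n.+1%:R * x)) k.

End scheme.

(** By compactness the image of the ultrafilter has a cluster point, and an ultrafilter converges to
    its cluster points. *)
Lemma bounded_ultra_cvg (G : set_system nat) (f : nat -> R) : UltraFilter G ->
  (forall n, 0 <= f n <= 1) -> exists l : R, f @ G --> l.
Proof.
move=> GU f01; have GP := @ultra_proper _ _ GU.
have [|l [_ hl]] := @segment_compact R 0 1 (f @ G) _.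
  by apply: (@filterS _ G _ setT) => [n _ /=|]; [rewrite in_itv /= f01|exact: filterT].
exists l => A Al; case: (in_ultra_setVsetC (f @^-1` A) GU) => // GA.
by have [x []] := hl (~` A) A GA Al.
Qed.

Lemma trunc_itv n (x : R) : 0 <= x <= 1 ->
  [/\ (Num.trunc (n.+1%:R * x) <= n.+1)%N,
   (Num.trunc (n.+1%:R * x))%:R / n.+1%:R <= x &
   x - n.+1%:R^-1 <= (Num.trunc (n.+1%:R * x))%:R / n.+1%:R].
Proof.
move=> /andP[x0 x1]; have nx0 : 0 <= n.+1%:R * x by rewrite mulr_ge0.
have /andP[t1 t2] := truncn_itv nx0; split.
- rewrite -(ler_nat R); apply: le_trans t1 _.
  by rewrite mulrC ler_piMl.
- by rewrite ler_pdivrMr// [leRHS]mulrC.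
- by rewrite ler_pdivlMr// mulrBl mulVf// [x * _]mulrC lerBlDr natr1 ltW.
Qed.

Lemma trunc_cvg (x : R) : 0 <= x <= 1 ->
  (Num.trunc (n.+1%:R * x))%:R / n.+1%:R @[n --> \oo] --> x.
Proof.
move=> x01; have h1 : x - n.+1%:R^-1 @[n --> \oo] --> x.
  rewrite -[X in _ --> X]subr0.
  by apply: cvgB; [exact: cvg_cst|exact: cvg_harmonic].
apply: squeeze_cvgr h1 (cvg_cst x).
by apply: nearW => n; have [_ -> ->] := trunc_itv n x01.
Qed.

(* Pointwise compactness of [0, 1] suffices here: the monotonicity of the scheme
   replaces any uniformity in the passage to the limit below. *)
Lemma polygon_limit : exists (G : set_system nat) (y : T -> R -> R),
  [/\ ProperFilter G, \oo `<=` G &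
   forall k x, 0 <= x <= 1 -> polygon n k x @[n --> G] --> y k x].
Proof.
have [G [GU ooG]] := ultraFilterLemma (F := \oo) _.
have h k x : exists l : R, 0 <= x <= 1 -> polygon n k x @[n --> G] --> l.
  have [x01|] := boolP (0 <= x <= 1); last by exists 0.
  have [|l hl] := @bounded_ultra_cvg G (fun n => polygon n k x) GU; last by exists l.
  by move=> n; apply: euler_itv; case: (trunc_itv n x01).
exists G, (fun k x => sval (cid (h k x))); split => //; first exact: ultra_proper.
by move=> k x; exact: (svalP (cid (h k x))).
Qed.

(** The limit of [euler_bounds]: the number of steps between the grid points below [s] and [t],
    times the step length, tends to [t - s], and the slopes converge by [gen_cvg]. *)
Lemma polygon_limit_bounds (G : set_system nat) (y : T -> R -> R) (s t : R) k :
  ProperFilter G -> \oo `<=` G ->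
  (forall k (x : R), 0 <= x <= 1 -> polygon n k x @[n --> G] --> y k x) ->
  0 <= s -> s <= t -> t <= 1 ->
  [/\ 0 <= y k s <= 1, (t - s) * gen (q k) (y ^~ t) <= y k t - y k s &
   y k t - y k s <= (t - s) * gen (q k) (y ^~ s)].
Proof.
move=> GP ooG hy s0 st t1.
have s01 : 0 <= s <= 1 by rewrite s0 (le_trans st).
have t01 : 0 <= t <= 1 by rewrite t1 (le_trans s0).
have y01 (x : R) j : 0 <= x <= 1 -> 0 <= y j x <= 1.
  move=> x01; apply/andP; split.
    apply: (cvgr_to_ge (hy j x x01)); apply: nearW => n.
    by have [+ _ _] := trunc_itv n x01 => /(@euler_itv n _ j)/andP[].
  apply: (cvgr_to_le (hy j x x01)); apply: nearW => n.
  by have [+ _ _] := trunc_itv n x01 => /(@euler_itv n _ j)/andP[].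
have gc (x : R) : 0 <= x <= 1 -> gen (q k) ((polygon n)^~ x) @[n --> G] --> gen (q k) (y^~ x).
  move=> x01; apply: gen_cvg => //; last 2 first.
  - by move=> j; exact: y01.
  - by move=> j; exact: hy.
  by apply: nearW => n j; apply: euler_itv; case: (trunc_itv n x01).
have tc (x : R) : 0 <= x <= 1 -> (Num.trunc (n.+1%:R * x))%:R / n.+1%:R @[n --> G] --> x.
  by move=> x01; apply: cvg_trans (trunc_cvg x01); exact: cvg_app.
have tsc : (Num.trunc (n.+1%:R * t) - Num.trunc (n.+1%:R * s))%:R * n.+1%:R^-1 @[n --> G] --> t - s.
  rewrite (_ : (fun n => _) = fun n => (Num.trunc (n.+1%:R * t))%:R / n.+1%:R
     - (Num.trunc (n.+1%:R * s))%:R / n.+1%:R).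
    by apply: cvgB; exact: tc.
  apply/funext => n; rewrite natrB ?mulrBl// le_truncn//.
  by rewrite ler_wpM2l.
have bnd n := @euler_bounds n (Num.trunc (n.+1%:R * s)) (Num.trunc (n.+1%:R * t)) k.
have le_t n : (Num.trunc (n.+1%:R * s) <= Num.trunc (n.+1%:R * t))%N.
  by rewrite le_truncn// ler_wpM2l.
have yc : polygon n k t - polygon n k s @[n --> G] --> y k t - y k s.
  by apply: cvgB; exact: hy.
split; first exact: y01.
- apply: (ler_cvg_to (cvgM tsc (gc _ t01)) yc); apply: nearW => n /=.
  by have [] := bnd n (le_t n); case: (trunc_itv n t01).
- apply: (ler_cvg_to yc (cvgM tsc (gc _ s01))); apply: nearW => n /=.
  by have [] := bnd n (le_t n); case: (trunc_itv n t01).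
Qed.

(** The bounds make every [y j] 1-Lipschitz, so [gen] is continuous along y; the difference quotient
    between [x] and [t] is squeezed between [gen] at [x] and at [t]. *)
Lemma derivative_of_bounds (y : T -> R -> R) k x :
  (forall s t k, 0 <= s -> s <= t -> t <= 1 ->
  [/\ 0 <= y k s <= 1, (t - s) * gen (q k) (y ^~ t) <= y k t - y k s &
   y k t - y k s <= (t - s) * gen (q k) (y ^~ s)]) -> 0 <= x <= 1 ->
  derivative_within `[0, 1] (y k) x (gen (q k) (y ^~ x)).
Proof.
move=> hy x01; pose F := within [set` `[0, 1]] (dnbhs x).
have y01 j t : 0 <= t <= 1 -> 0 <= y j t <= 1.
  by move=> /andP[t0 t1]; have [] := hy t t j t0 (lexx _) t1.
have g01 j t : 0 <= t <= 1 -> 0 <= gen (q j) (y ^~ t) <= 1.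
  by move=> t01; apply: gen_itv => // i; exact: y01.
have F01 : \forall t \near F, 0 <= t <= 1.
  by apply: (filterS _ (withinT _ _)) => t; rewrite /= in_itv.
have FN : \forall t \near F, t != x.
  by apply: cvg_within; apply: (filterS _ (withinT _ _)).
have lip j s t : 0 <= s -> s <= t -> t <= 1 -> 0 <= y j t - y j s <= t - s.
  move=> s0 st t1; have [_ h1 h2] := hy s t j s0 st t1.
  have /andP[gt0 _] : 0 <= gen (q j) (y ^~ t) <= 1 by apply: g01; lra.
  have /andP[_ gs1] : 0 <= gen (q j) (y ^~ s) <= 1 by apply: g01; lra.
  nra.
have yc j : y j t @[t --> F] --> y j x.
  apply/cvgrPdist_le => e e0.
  have Fe : \forall t \near F, `|x - t| <= e.
    have : \forall t \near x, `|x - t| <= e.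
      exact: (cvgrPdist_le (id : R -> R) x).1 (@cvg_id _ _) _ e0.
    by move=> h; apply: cvg_within; apply: cvg_within.
  near=> t.
  have : `|x - t| <= e by near: t.
  have t01 : 0 <= t <= 1 by near: t.
  have [xt|/ltW tx] := leP x t.
    have : 0 <= y j t - y j x <= t - x by apply: lip; lra.
    by rewrite !ler_norml; lra.
  have : 0 <= y j x - y j t <= x - t by apply: lip; lra.
  by rewrite !ler_norml; lra.
have gc : gen (q k) (y ^~ t) @[t --> F] --> gen (q k) (y ^~ x).
  apply: gen_cvg => //; last by move=> j; exact: y01.
  by near=> t => j; apply: y01; near: t.
apply/cvgrPdist_le => e e0; move/cvgrPdist_le : gc => /(_ _ e0) gc.
near=> t.
have : `|gen (q k) (y^~ x) - gen (q k) (y^~ t)| <= e by near: t.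
have t01 : 0 <= t <= 1 by near: t.
have tx : t != x by near: t.
suff : `|gen (q k) (y^~ x) - (y k t - y k x) / (t - x)| <=
       `|gen (q k) (y^~ x) - gen (q k) (y^~ t)| by exact: le_trans.
have [xt|tx'|/eqP] := ltgtP x t; last by rewrite eq_sym (negPf tx).
  have [_ h1 h2] : [/\ 0 <= y k x <= 1, (t - x) * gen (q k) (y ^~ t) <= y k t - y k x &
   y k t - y k x <= (t - x) * gen (q k) (y ^~ x)] by apply: hy; lra.
  have tx0 : 0 < t - x by lra.
  have : gen (q k) (y ^~ t) <= (y k t - y k x) / (t - x) by rewrite ler_pdivlMr// mulrC.
  have : (y k t - y k x) / (t - x) <= gen (q k) (y ^~ x) by rewrite ler_pdivrMr// mulrC.
  by move=> *; rewrite !ger0_norm; lra.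
have [_ h1 h2] : [/\ 0 <= y k t <= 1, (x - t) * gen (q k) (y ^~ x) <= y k x - y k t &
   y k x - y k t <= (x - t) * gen (q k) (y ^~ t)] by apply: hy; lra.
have tx0 : 0 < x - t by lra.
have -> : (y k t - y k x) / (t - x) = (y k x - y k t) / (x - t).
  by rewrite -opprB -[t - x]opprB invrN mulrNN.
have : (y k x - y k t) / (x - t) <= gen (q k) (y ^~ t) by rewrite ler_pdivrMr// mulrC.
have : gen (q k) (y ^~ x) <= (y k x - y k t) / (x - t) by rewrite ler_pdivlMr// mulrC.
by move=> *; rewrite !ler0_norm; lra.
Unshelve. all: by end_near.
Qed.

End euler.

(** * Independence of disjoint groups of variables *)

Section independence.
Context d (Omega : measurableType d) (R : realType) (P : probability Omega R).
Local Open Scope ereal_scope.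

(** Two finite measures, [P] restricted to [B] and [P] scaled by [P B], agree on the pi-system [C],
    hence on the sigma-algebra that it generates. *)
Lemma independent_sigma (C : set_system Omega) (B : set Omega) :
  C setT -> setI_closed C -> C `<=` measurable -> measurable B ->
  (forall A, C A -> P (A `&` B) = P A * P B) ->
  forall A, <<s C >> A -> P (A `&` B) = P A * P B.
Proof.
move=> CT CI Cm mB CB A sA.
have PB0 : (0 <= fine (P B))%R by rewrite fine_ge0.
pose m2 := mscale (NngNum PB0) P.
have m2E D : m2 D = P D * P B.
  by rewrite -[X in _ * X](@fineK _ (P B)) ?fin_num_measure// muleC.
rewrite -m2E.
apply: (@g_sigma_algebra_measure_unique _ _ _ C Cm (fun=> setT) (fun=> CT) _
  (mrestr P mB) m2) => //.
- by rewrite bigcup_const.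
- by move=> D CD; transitivity (P D * P B); [exact: CB|exact/esym/m2E].
- by move=> k; rewrite /mrestr (le_lt_trans (probability_le1 _ _)) ?ltry// setTI.
Qed.

Variables (I : choiceType) (F : I -> set_system Omega).

Definition events (K : set I) : set_system Omega := <<s \bigcup_(i in K) F i >>.

(** A pi-system generating [events K]. The family [E] is total, equal to [setT] off a finite set, so
    that rectangles intersect coordinatewise. *)
Definition rectangles (K : set I) : set_system Omega :=
  [set A | exists (J : {fset I}) (E : I -> set Omega),
    [/\ forall i, i \in J -> K i, forall i, F i (E i),
        forall i, i \notin J -> E i = setT & A = \bigcap_i E i]].

Hypotheses (Fm : forall i, F i `<=` measurable) (FT : forall i, F i setT)
  (FI : forall i, setI_closed (F i)).

Lemma rectangles_setT K : rectangles K setT.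
Proof.
exists fset0, (fun=> setT); split => //.
by apply/seteqP; split=> // w _ i _.
Qed.

Lemma rectangles_setI K : setI_closed (rectangles K).
Proof.
move=> _ _ [J [E [JK FE ET ->]]] [J' [E' [JK' FE' ET' ->]]].
exists (J `|` J')%fset, (fun i => E i `&` E' i); split.
- by move=> i; rewrite in_fsetU => /orP[/JK|/JK'].
- by move=> i; apply: FI.
- by move=> i; rewrite in_fsetU negb_or => /andP[/ET -> /ET' ->]; rewrite setIT.
- by rewrite bigcapI.
Qed.

Lemma rectangles_bigcap (J : {fset I}) (E : I -> set Omega) :
  (forall i, i \notin J -> E i = setT) ->
  \bigcap_i E i = \bigcap_(i in [set` J]) E i.
Proof.
move=> ET; apply/seteqP; split=> w wE i // _; first exact: wE.
by have [/wE//|/ET ->] := boolP (i \in J).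
Qed.

Lemma rectangles_measurable K : rectangles K `<=` measurable.
Proof.
move=> _ [J [E [JK FE ET ->]]]; rewrite (rectangles_bigcap ET).
by apply: fin_bigcap_measurable => // i _; exact: (@Fm i).
Qed.

Lemma events_rectangles K : events K `<=` <<s rectangles K >>.
Proof.
apply: smallest_sub; first exact: smallest_sigma_algebra.
move=> A [i Ki FA]; apply: sub_gen_smallest; exists [fset i]%fset.
exists (fun j => if j == i then A else setT); split.
- by move=> j; rewrite inE => /eqP ->.
- by move=> j; case: eqP => [->|].
- by move=> j; rewrite inE => /negPf ->.
- apply/seteqP; split=> [w Aw j _|w]; first by case: eqP.
  by move=> /(_ i Logic.I); rewrite eqxx.
Qed.

Lemma events_measurable K : events K `<=` measurable.
Proof.
apply: smallest_sub; first exact: sigma_algebra_measurable.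
by move=> A [i _]; exact: Fm.
Qed.

Lemma sub_events K L : K `<=` L -> events K `<=` events L.
Proof.
move=> KL; apply: smallest_sub; first exact: smallest_sigma_algebra.
by move=> A [i Ki FA]; apply: sub_gen_smallest; exists i => //; exact: KL.
Qed.

Lemma events_gen K i A : K i -> F i A -> events K A.
Proof. by move=> Ki FA; apply: sub_gen_smallest; exists i. Qed.

Hypothesis indepF : mutually_independent P F.

Lemma rectangles_probability (J J' : {fset I}) (E : I -> set Omega) :
  (forall i, F i (E i)) -> (forall i, i \notin J -> E i = setT) ->
  P (\bigcap_i E i) = \prod_(i <- J) P (E i).
Proof. by move=> FE ET; rewrite (rectangles_bigcap ET) indepF. Qed.

Lemma independent_rectangles K L A B : K `&` L = set0 ->
  rectangles K A -> rectangles L B -> P (A `&` B) = P A * P B.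
Proof.
move=> KL [J [E [JK FE ET ->]]] [J' [E' [JK' FE' ET' ->]]].
have JJ' i : i \in J -> i \notin J'.
  by move=> /JK Ki; apply/negP => /JK' Li; have : set0 i by rewrite -KL.
rewrite -bigcapI (@rectangles_probability (J `|` J')%fset)//; last first.
- by move=> i; rewrite in_fsetU negb_or => /andP[/ET -> /ET' ->]; rewrite setIT.
- by move=> i; exact: FI.
rewrite (big_fset_sub _ _ (fsubsetUl J J')) /=.
rewrite (_ : ((J `|` J') `\` J)%fset = J'); last first.
  apply/fsetP => i; rewrite !inE; case: (boolP (i \in J)) => //= /JJ' iJ'.
  exact/esym/negbTE.
rewrite (@rectangles_probability J)// (@rectangles_probability J')//.
congr (_ * _); rewrite big_seq [RHS]big_seq; apply: eq_bigr => i iJ.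
  by rewrite ET' ?setIT//; exact: JJ'.
by rewrite ET ?setTI//; apply: contraL iJ; exact: JJ'.
Qed.

Lemma independent_events K L A B : K `&` L = set0 ->
  events K A -> events L B -> P (A `&` B) = P A * P B.
Proof.
move=> KL /events_rectangles KA LB.
have mB := events_measurable LB; move/events_rectangles : LB => LB.
apply: (independent_sigma (@rectangles_setT K) (@rectangles_setI K)
  (@rectangles_measurable K) mB _ KA) => {KA}A KA.
rewrite setIC muleC.
apply: (independent_sigma (@rectangles_setT L) (@rectangles_setI L)
  (@rectangles_measurable L) (rectangles_measurable KA) _ LB) => {mB LB}B LB.
by rewrite setIC muleC (independent_rectangles KL).
Qed.

(** One group is split off at a time. The first conclusion keeps the intersection of the others
    inside the events of their joint indices, which the induction needs. *)
Lemma independent_list (X : eqType) (s : seq X) (K : X -> set I)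
    (A : X -> set Omega) : uniq s ->
  (forall x y, x \in s -> y \in s -> x != y -> K x `&` K y = set0) ->
  (forall x, x \in s -> events (K x) (A x)) ->
  events (\bigcup_(x in [set` s]) K x) (\bigcap_(x in [set` s]) A x) /\
  P (\bigcap_(x in [set` s]) A x) = \prod_(x <- s) P (A x).
Proof.
elim: s => [|x s IH] /=.
  move=> _ _ _; rewrite big_nil set_nil bigcap_set0 probability_setT; split=> //.
  exact: (@measurableT _ (g_sigma_algebraType _)).
move=> /andP[xs us] Kd KA; have [||eA PA] := IH us.
- by move=> y z ys zs; apply: Kd; rewrite inE (ys, zs) orbT.
- by move=> y ys; apply: KA; rewrite inE ys orbT.
have -> : [set` x :: s] = x |` [set` s].
  apply/seteqP; split=> y /=; first by rewrite inE => /orP[/eqP|]; [left|right].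
  by case=> [->|ys]; rewrite inE ?eqxx// ys orbT.
rewrite big_cons bigcap_setU1 bigcup_setU1; split.
  apply: (@measurableI _ (g_sigma_algebraType _)).
    by apply: (sub_events (K := K x)) => [w|]; [left|apply: KA; rewrite inE eqxx].
  by apply: sub_events eA => w; right.
rewrite -PA; apply: (@independent_events (K x) _ _ _ _ _ eA); last first.
  by apply: KA; rewrite inE eqxx.
rewrite setI_bigcupr; apply: bigcup0 => y /= ys; apply: Kd.
- by rewrite inE eqxx.
- by rewrite inE ys orbT.
- by apply: contraNneq xs => ->.
Qed.

End independence.

Section joint_independence.
Context d (Omega : measurableType d) (R : realType) (P : probability Omega R).
Variables (I J : choiceType) (F : I -> set_system Omega)
  (G : option J -> set_system Omega).

Definition joint_events (x : I + J) : set_system Omega :=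
  match x with inl i => F i | inr j => G (Some j) end.

(** The labels are independent of the sigma-algebra of the whole process, at index [None]. The
    process events of a finite family are merged into one event there, whose probability then
    factors by independence within the process. *)
Lemma mutually_independent_joint : (forall i, F i setT) ->
  (forall K : {fset I}, forall A, (forall i, F i (A i)) ->
     G None (\bigcap_(i in [set` K]) A i)) ->
  mutually_independent P F -> mutually_independent P G ->
  mutually_independent P joint_events.
Proof.
move=> FT FG indF indG K A KA.
pose KI := [fset i in pmap (fun x : I + J => if x is inl i then Some i else None) K]%fset.
pose KJ := [fset j in pmap (fun x : I + J => if x is inr j then Some j else None) K]%fset.
have inKI i : (i \in KI) = (inl i \in K).
  rewrite inE mem_pmap; apply/mapP/idP => [[[i'|//] iK [->]]//|iK].
  by exists (inl i).
have inKJ j : (j \in KJ) = (inr j \in K).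
  rewrite inE mem_pmap; apply/mapP/idP => [[[//|j'] jK [->]]//|jK].
  by exists (inr j).
have KE : perm_eq K (map inl KI ++ map inr KJ).
  apply: uniq_perm; rewrite ?fset_uniq//.
    rewrite cat_uniq !map_inj_uniq ?fset_uniq//=; first last.
    - by move=> ? ? [].
    - by move=> ? ? [].
    by rewrite andbT; apply/hasPn => _ /mapP[j _ ->]; apply/mapP => -[].
  move=> [i|j]; rewrite mem_cat.
    rewrite mem_map; last by move=> ? ? [].
    by rewrite inKI [X in _ || X](_ : _ = false) ?orbF//; apply/mapP => -[].
  rewrite orbC mem_map; last by move=> ? ? [].
  by rewrite inKJ [X in _ || X](_ : _ = false) ?orbF//; apply/mapP => -[].
rewrite (perm_big _ KE) big_cat !big_map /=.
pose E i := if i \in KI then A (inl i) else setT.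
have FE i : F i (E i).
  by rewrite /E; case: ifPn => //; rewrite inKI => /KA.
have <- : P (\bigcap_(i in [set` KI]) E i) = (\prod_(i <- KI) P (A (inl i)))%E.
  by rewrite indF// big_seq [RHS]big_seq; apply: eq_bigr => i iK; rewrite /E iK.
pose A' (x : option J) := if x is Some j then A (inr j) else \bigcap_(i in [set` KI]) E i.
have := indG (None |` (some @` KJ))%fset A'.
rewrite big_fsetU1/=; last by apply/negP => /imfsetP[].
rewrite big_imfset /=; last by move=> ? ? _ _ [].
move=> <-; last first.
  move=> [j|] /=; last by move=> _; exact: FG.
  rewrite !inE /= => /imfsetP[j' /= j'K [->]].
  by apply: (KA (inr j')); rewrite -inKJ.
congr (P _); apply/seteqP; split=> [w h [j|]|w h [i|j] xK] /=.
- rewrite !inE /= => /imfsetP[j' /= j'K [->]].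
  by apply: (h (inr j')); rewrite /= -inKJ.
- by move=> _ i /= iK; rewrite /E iK; apply: (h (inl i)); rewrite /= -inKI.
- have := h None; rewrite /= !inE => /(_ isT i).
  by rewrite /= inKI xK /E inKI xK => /(_ isT).
- apply: (h (Some j)); rewrite /= !inE /=; apply/imfsetP; exists j => //=.
  by rewrite inKJ.
Qed.

End joint_independence.

(** * The discretized selection on the tree *)

Section measure_complements.
Context d (Omega : measurableType d) (R : realType) (P : probability Omega R).

Lemma countable_bigcapT_measurable (I : countType) (A : I -> set Omega) :
  (forall i, measurable (A i)) -> measurable (\bigcap_i A i).
Proof.
move=> mA; rewrite -[X in measurable X]setCK setC_bigcap; apply: measurableC.
by apply: countable_bigcupT_measurable => [|i]; [exact: countableP|exact: measurableC].
Qed.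

(** Countable additivity transported along [pickle]; integers that encode no index receive the empty
    set. *)
Lemma has_sum_partition (I : countType) (A : I -> set Omega) :
  (forall i, measurable (A i)) -> trivIset setT A ->
  has_sum (fun i => fine (P (A i))) (fine (P (\bigcup_i A i))).
Proof.
move=> mA tA.
have mU : measurable (\bigcup_i A i).
  by apply: countable_bigcupT_measurable => //; exact: countableP.
rewrite /has_sum fineK ?fin_num_measure//.
under eq_esum do rewrite fineK ?fin_num_measure//.
pose B n := oapp A set0 (@pickle_inv I n).
have mB n : measurable (B n).
  by rewrite /B; case: (@pickle_inv I n) => [i|] /=; [exact: mA|exact: measurable0].
have BA i : B (choice.pickle i) = A i by rewrite /B pickleK_inv.
have -> : \bigcup_i A i = \bigcup_n B n.
  apply/seteqP; split=> [w [i _ Aiw]|w [n _]]; first by exists (choice.pickle i); rewrite ?BA.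
  by rewrite /B; case: (@pickle_inv I n) => // i Aiw; exists i.
rewrite measure_bigcup//; last first.
  move=> m n _ _ [w []]; rewrite /B.
  have := @pickle_invK I m; have := @pickle_invK I n.
  case: (@pickle_inv I n) => //= i hn; case: (@pickle_inv I m) => //= j hm Aj Ai.
  by rewrite -hn -hm; congr choice.pickle; apply: tA => //; exists w.
rewrite (eq_eseriesl (Q := xpredT)); last by move=> n; rewrite in_setT.
rewrite nneseries_esumT//.
under [LHS]eq_esum do rewrite -BA.
rewrite -(esum_image [set: I] choice.pickle (P \o B)); last first.
  by move=> i j _ _; apply: (pcan_inj (@choice.pickleK I)).
rewrite [RHS]esum_mkcond esum_mkcond; apply: eq_esum => n _.
rewrite in_setT; case: ifPn => //; rewrite notin_setE /= => hn.
rewrite /B; have := @pickle_invK I n; case: (@pickle_inv I n) => //= i hi.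
by exfalso; apply: hn; exists i.
Qed.

Lemma probability_setI_full (A B : set Omega) : measurable A -> measurable B ->
  P B = 1%E -> P (A `&` B) = P A.
Proof.
move=> mA mB PB.
have PC : P (A `\` B) = 0%E.
  apply/eqP; rewrite eq_le measure_ge0 andbT.
  rewrite (@le_trans _ _ (P (~` B)))//.
    by apply: le_measure; rewrite ?inE; [exact: measurableD|exact: measurableC|move=> w []].
  by rewrite probability_setC// PB subee.
have h : P A = (P (A `\` B) + P (A `&` B))%E := measureDI P mA mB.
by rewrite h PC add0e.
Qed.

End measure_complements.

Lemma uniform01 (R : realType) (A : set R) : measurable A -> A `<=` `[0, 1] ->
  uniform_prob (@ltr01 R) A = lebesgue_measure A.
Proof.
move=> mA A01; rewrite /uniform_prob (eq_integral (fun=> 1%:E)).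
  by rewrite integral_cst// mul1e.
move=> x; rewrite inE => /A01 /=; rewrite in_itv /= /uniform_pdf => ->.
by rewrite subr0 invr1.
Qed.

Section branching.
Context d (Omega : measurableType d) (R : realType) (P : probability Omega R)
  (T : countType) (mudot : T -> R) (mu : T -> probability (offspring T) R)
  (tau : Omega -> T) (xi : node T -> T -> {mfun Omega >-> offspring T})
  (sigma : node T -> {RV P >-> R}).
Hypotheses (hU : branching_process P tau xi mudot mu)
  (hsigma : random_labelling tau xi sigma).

Local Notation vars := (option (node T * T) + node T)%type.
Local Notation fsvec := {fsfun T -> nat with 0%N}.

Definition var_events : vars -> set_system Omega :=
  joint_events (process_events tau xi) (labelling_events tau xi sigma).

Lemma preimage_set_system_setT (S : Type) (G : set_system S) (f : Omega -> S) :
  G setT -> preimage_set_system setT f G setT.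
Proof. by move=> GT; exists setT => //; rewrite preimage_setT setTI. Qed.

Lemma preimage_set_system_setI_closed (S : Type) (G : set_system S) (f : Omega -> S) :
  setI_closed G -> setI_closed (preimage_set_system setT f G).
Proof.
move=> GI _ _ [A GA <-] [B GB <-]; exists (A `&` B); first exact: GI.
by rewrite !setTI preimage_setI.
Qed.

Lemma process_events_setT i : process_events tau xi i setT.
Proof. by case: i => [[v k]|]; apply: preimage_set_system_setT. Qed.

Lemma process_events_measurable i : process_events tau xi i `<=` measurable.
Proof.
case: i => [[v k]|] _ [A mA <-] /=.
  exact: measurable_funP.
rewrite setTI [X in measurable X](_ : _ =
    \bigcup_k (tau @^-1` [set k] `&` [set w | A k])).
  apply: countable_bigcupT_measurable => [|k]; first exact: countableP.
  apply: measurableI; first exact: (root_measurable hU).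
  have [Ak|nAk] := pselect (A k).
    by rewrite (_ : [set _ | _] = setT)//; apply/seteqP; split.
  by rewrite (_ : [set _ | _] = set0)//; apply/seteqP; split.
apply/seteqP; split=> [w Aw|w [k _ [/= h Ak]]]; first by exists (tau w).
by rewrite /= h.
Qed.

Lemma var_events_measurable i : var_events i `<=` measurable.
Proof.
case: i => [i|v]; first exact: process_events_measurable.
by move=> _ [A mA <-]; exact: measurable_funP.
Qed.

Lemma var_events_setT i : var_events i setT.
Proof.
case: i => [i|v]; first exact: process_events_setT.
exact: preimage_set_system_setT.
Qed.

Lemma var_events_setI i : setI_closed (var_events i).
Proof.
case: i => [[[v k]|]|v]; apply: preimage_set_system_setI_closed => //; exact: measurableI.
Qed.

Lemma var_independent : mutually_independent P var_events.
Proof.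
apply: mutually_independent_joint; last 2 first.
- exact: (process_independent hU).
- exact: (labelling_independent hsigma).
- exact: process_events_setT.
move=> K A KA; apply: (@fin_bigcap_measurable _ (g_sigma_algebraType _)) => //.
by move=> i _; apply: sub_gen_smallest; exists i.
Qed.

Local Notation events := (events var_events).

Lemma eventsW K A : events K A -> measurable A.
Proof. exact: (events_measurable var_events_measurable). Qed.

Lemma indep_events K L A B : K `&` L = set0 -> events K A -> events L B ->
  P (A `&` B) = (P A * P B)%E.
Proof.
exact: (independent_events var_events_measurable var_events_setT
  var_events_setI var_independent).
Qed.

(** Half-open, so that cells are disjoint; the label 1, of probability 0, is in none of the first n
    + 1. *)
Definition cell n m : set R := `[m%:R / n.+1%:R, m.+1%:R / n.+1%:R[.

(* [selected n m v t]: regarded as a node of type t, v has its label in one of the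
   first m cells and no selected child in a strictly smaller cell. *)
Fixpoint selected n m (v : node T) (t : T) : set Omega :=
  if m is m'.+1 then
    selected n m' v t `|` (sigma v @^-1` cell n m' `&`
      \bigcap_(c : T * nat) ~` ([set w | (c.2 < xi v t w c.1)%N] `&`
                               selected n m' (c :: v) c.1))
  else set0.

(** The last factor in the recursion of [selected]. The label of [v] does not enter, so this event
    is independent of it. *)
Definition unblocked n m v t : set Omega :=
  \bigcap_(c : T * nat) ~` ([set w | (c.2 < xi v t w c.1)%N] `&`
                           selected n m (c :: v) c.1).

(* The indices of the variables that determine the subtree at v: [inl (Some (u, k))]
   stands for the offspring vector of u at type k, [inr u] for the label of u and
   [inl None] for the type of the root. *)
Definition below (v : node T) : set vars := fun x =>
  match x with
  | inl None => False
  | inl (Some (u, _)) => suffix v u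
  | inr u => suffix v u
  end.

Definition strictly_below v : set vars := \bigcup_c below (c :: v).

Lemma suffix_cons_trans (c : T * nat) v u : suffix (c :: v) u -> suffix v u.
Proof. by move=> /suffixP[s ->]; apply/suffixP; exists (rcons s c); rewrite cat_rcons. Qed.

Lemma strictly_below_sub v : strictly_below v `<=` below v.
Proof. by move=> [[[u k]|]|u] [c _] //=; exact: suffix_cons_trans. Qed.

Lemma suffix_cons_self (c : T * nat) (v : node T) : ~~ suffix (c :: v) v.
Proof. by apply/negP => /size_suffix /=; rewrite ltnn. Qed.

Lemma below_disjoint (c c' : T * nat) v : c != c' ->
  below (c :: v) `&` below (c' :: v) = set0.
Proof.
move=> cc'; have h u : suffix (c :: v) u -> suffix (c' :: v) u -> False.
  rewrite !suffixE /= => /eqP h1 /eqP h2; move: cc'.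
  by have := h1; rewrite h2 => -[->]; rewrite eqxx.
by apply/seteqP; split => // -[[[u k]|]|u] /= [] //; exact: h.
Qed.

Lemma offspring_event v t j (B : set nat) :
  events [set inl (Some (v, t))] [set w | B (xi v t w j)].
Proof.
apply: (events_gen (i := inl (Some (v, t)))) => //=.
exists [set l : offspring T | B (l j)]; last by rewrite setTI.
by apply: sub_gen_smallest; exists j, B.
Qed.

Lemma label_event v (B : set R) : measurable B ->
  events [set inr v] (sigma v @^-1` B).
Proof.
by move=> mB; apply: (events_gen (i := inr v)) => //=; exists B => //; rewrite setTI.
Qed.

Lemma selected_events n m v t : events (below v) (selected n m v t).
Proof.
elim: m v t => [|m IH] v t.
  exact: (@measurable0 _ (g_sigma_algebraType _)).
apply: (@measurableU _ (g_sigma_algebraType _)); first exact: IH.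
apply: (@measurableI _ (g_sigma_algebraType _)).
  apply: (sub_events (K := [set inr v])) => [_ ->|]; first exact: suffix_refl.
  by apply: label_event; exact: measurable_itv.
apply: (@countable_bigcapT_measurable _ (g_sigma_algebraType _)) => c.
apply: (@measurableC _ (g_sigma_algebraType _)).
apply: (@measurableI _ (g_sigma_algebraType _)).
  apply: (sub_events (K := [set inl (Some (v, t))])) => [_ ->|]; first exact: suffix_refl.
  exact: (offspring_event c.1 (fun k => c.2 < k)%N).
by apply: sub_events (IH _ _) => x h; apply: strictly_below_sub; exists c.
Qed.

Arguments selected_events : clear implicits.

Lemma unblocked_events n m v t :
  events ([set inl (Some (v, t))] `|` strictly_below v) (unblocked n m v t).
Proof.
apply: (@countable_bigcapT_measurable _ (g_sigma_algebraType _)) => c.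
apply: (@measurableC _ (g_sigma_algebraType _)).
apply: (@measurableI _ (g_sigma_algebraType _)).
  apply: (sub_events (K := [set inl (Some (v, t))])) => [x ->|]; first by left.
  exact: (offspring_event c.1 (fun k => c.2 < k)%N).
by apply: sub_events (selected_events n m (c :: v) c.1) => x h; right; exists c.
Qed.

Arguments unblocked_events : clear implicits.

Lemma label_cell n m v : (m < n.+1)%N ->
  P (sigma v @^-1` cell n m) = (n.+1%:R^-1)%:E.
Proof.
move=> mn; have mc : measurable (cell n m) by exact: measurable_itv.
have := label_law hsigma v mc; rewrite /distribution /pushforward => ->.
have n0 : 0 < n.+1%:R :> R by [].
have mm : m%:R / n.+1%:R < m.+1%:R / n.+1%:R :> R.
  by rewrite ltr_pM2r ?invr_gt0// ltr_nat.
rewrite uniform01//; last first.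
  move=> x /=; rewrite !in_itv /= => /andP[h1 /ltW h2]; apply/andP; split.
    by move: h1; rewrite bnd_simp; apply: le_trans; rewrite divr_ge0.
  by apply: (le_trans h2); rewrite ler_pdivrMr// mul1r ler_nat.
rewrite lebesgue_measure_itv /= lte_fin mm -EFinD -mulrBl -natrB//.
by rewrite subSnn mul1r.
Qed.

Definition children (l : fsvec) : seq (T * nat) :=
  [seq (j, i) | j <- finsupp l, i <- iota 0 (l j)].

Lemma mem_children l c : (c \in children l) = (c.2 < l c.1)%N.
Proof.
apply/allpairsPdep/idP => [[j [i [jl]]]|].
  by rewrite mem_iota /= add0n => il ->.
case: c => j i /= il; exists j, i; split=> //; last by rewrite mem_iota add0n.
by rewrite mem_finsupp; case: (l j) il.
Qed.

Lemma children_uniq l : uniq (children l).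
Proof.
apply: allpairs_uniq_dep => [|j _|]; [exact: fset_uniq|exact: iota_uniq|].
by move=> [a b] [a' b'] _ _ /= [<- <-].
Qed.

Lemma measurable_offspring1 (l : T -> nat) : measurable [set l : offspring T].
Proof.
rewrite [X in measurable X](_ : _ = \bigcap_j [set l' : offspring T | l' j = l j]).
  apply: countable_bigcapT_measurable => j.
  by apply: sub_gen_smallest; exists j, [set l j].
apply/seteqP; split=> [_ -> //|l' /= h].
by apply/funext => j; exact: h.
Qed.

Definition pmass k (l : fsvec) : R := fine (mu k [set (l : T -> nat) : offspring T]).

Hypothesis hfin : forall k, has_sum (pmass k) 1.

Lemma pmass_ge0 k l : 0 <= pmass k l. Proof. exact: fine_ge0. Qed.

Lemma offspring1_probability v t (l : fsvec) :
  P (xi v t @^-1` [set (l : T -> nat)]) = (pmass t l)%:E.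
Proof.
have := offspring_law hU v t (measurable_offspring1 l).
rewrite /distribution /pushforward /pmass => ->; rewrite fineK// fin_num_measure//.
exact: measurable_offspring1.
Qed.

(** Split according to the offspring vector, almost surely finitely supported. When it equals [l],
    the event says that none of the finitely many [children l] is selected; these events live in
    disjoint subtrees and are independent of the vector at [v]. *)
Lemma unblocked_probability n m v t (y : T -> R) :
  (forall c : T * nat, P (selected n m (c :: v) c.1) = (y c.1)%:E) ->
  (forall j, 0 <= y j <= 1) ->
  P (unblocked n m v t) = (gen (pmass t) y)%:E.
Proof.
move=> hy y01; have mS c := eventsW (selected_events n m (c :: v) c.1).
pose X (l : fsvec) := xi v t @^-1` [set (l : T -> nat)].
have eX l : events [set inl (Some (v, t))] (X l).
  apply: (events_gen (i := inl (Some (v, t)))) => //=.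
  by exists [set (l : T -> nat)]; [exact: measurable_offspring1|rewrite setTI].
have tX : trivIset setT X.
  move=> l l' _ _ [w [/= h h']]; apply/fsfunP => j.
  by rewrite -[l j]/((l : T -> nat) j) -h h'.
have mX l : measurable (X l) := eventsW (eX l).
have PX : P (\bigcup_l X l) = 1%E.
  have := has_sum_partition P mX tX; have mU : measurable (\bigcup_l X l).
    by apply: countable_bigcupT_measurable => //; exact: countableP.
  have -> : (fun l : fsvec => fine (P (X l))) = pmass t.
    by apply/funext => l; rewrite (congr1 fine (offspring1_probability v t l)).
  move=> /(has_sum_inj (hfin t)) h.
  by rewrite -[LHS]fineK ?fin_num_measure// -h.
have mU : measurable (unblocked n m v t) := eventsW (unblocked_events n m v t).
have mUX : measurable (\bigcup_l X l).
  by apply: countable_bigcupT_measurable => //; exact: countableP.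
rewrite -(probability_setI_full mU mUX PX) setI_bigcupr.
have mUXl l : measurable (unblocked n m v t `&` X l) by exact: measurableI.
have tUX : trivIset setT (fun l => unblocked n m v t `&` X l).
  by move=> l l' _ _ [w [[_ h] [_ h']]]; apply: tX => //; exists w.
have := has_sum_partition P mUXl tUX.
rewrite (_ : (fun l => _) = fun l : fsvec => pmass t l * fsmonomial (fun j => 1 - y j) l).
  move=> /(has_sum_inj (has_sum_gen (@pmass_ge0 t) (hfin t) y01)) ->.
  rewrite fineK// fin_num_measure//.
  by apply: countable_bigcupT_measurable => //; exact: countableP.
apply/funext => l.
have -> : unblocked n m v t `&` X l =
    X l `&` \bigcap_(c in [set` children l]) ~` selected n m (c :: v) c.1.
  apply/seteqP; split=> w [].
    move=> h hX; split=> // c /=; rewrite mem_children => cl s.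
    by apply: (h c) => //; split=> //; rewrite /= hX.
  move=> hX h; split=> // c _ [/= cl]; apply: h.
  by rewrite /= mem_children; move: cl; rewrite hX.
have [eC PC] := independent_list var_events_measurable var_events_setT
  var_events_setI var_independent (K := fun c => below (c :: v))
  (A := fun c => ~` selected n m (c :: v) c.1) (children_uniq l)
  (fun c c' _ _ cc' => below_disjoint v cc')
  (fun c _ => @measurableC _ (g_sigma_algebraType _) _ (selected_events n m (c :: v) c.1)).
rewrite (indep_events _ (eX l) eC); last first.
  apply/seteqP; split=> // _ [-> [c _]] /=.
  by apply/negP; exact: suffix_cons_self.
rewrite PC offspring1_probability.
under eq_bigr do rewrite probability_setC// hy.
rewrite -[RHS]/(fine (_)%:E) EFinM /fsmonomial.
congr (fine (_ * _)).
rewrite prodEFin; congr EFin.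
rewrite /children big_allpairs_dep /=; apply: eq_bigr => j _.
by rewrite big_const_seq count_predT size_iota -Monoid.iteropE.
Qed.

Lemma selected_label n m v t :
  selected n m v t `<=` [set w | 0 <= sigma v w < m%:R / n.+1%:R].
Proof.
elim: m => [//|m IH] w [/IH /= /andP[-> h]|[/=]].
  by rewrite (lt_trans h)// ltr_pM2r ?invr_gt0// ltr_nat.
rewrite /cell /= in_itv /= => /andP[h ->] _; rewrite andbT.
by apply: le_trans h; rewrite divr_ge0.
Qed.

(** Passing from [m] to m + 1 adds an event disjoint from the previous one, by [selected_label]. It
    is the intersection of two independent events, of probabilities 1 / (n + 1) and [gen] of the
    previous iterate: one Euler step. *)
Lemma selected_probability n m v t : (m <= n.+1)%N ->
  P (selected n m v t) = (euler pmass n m t)%:E.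
Proof.
elim: m v t => [|m IH] v t mn; first by rewrite /= measure0.
have {}IH v' t' := IH v' t' (ltnW mn).
have y01 j : 0 <= euler pmass n m j <= 1.
  by apply: euler_itv; [exact: pmass_ge0|exact: hfin|exact: ltnW].
have eL : events [set inr v] (sigma v @^-1` cell n m).
  by apply: label_event; exact: measurable_itv.
have eB := unblocked_events n m v t.
have dLB : [set inr v] `&` ([set inl (Some (v, t))] `|` strictly_below v) = set0.
  apply/seteqP; split=> // _ [-> [//|[c _]]] /=.
  by apply/negP; exact: suffix_cons_self.
have dAB : selected n m v t `&` (sigma v @^-1` cell n m `&` unblocked n m v t) = set0.
  apply/seteqP; split=> // w [/selected_label /= /andP[_ h1] [/=]]; rewrite /cell.
  by rewrite /= in_itv /= => /andP[h2 _] _; have := lt_le_trans h1 h2; rewrite ltxx.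
have mA : measurable (selected n m v t) := eventsW (selected_events n m v t).
have mB : measurable (sigma v @^-1` cell n m `&` unblocked n m v t).
  by apply: measurableI; [exact: eventsW eL|exact: eventsW eB].
transitivity (P (selected n m v t) + P (sigma v @^-1` cell n m `&` unblocked n m v t))%E.
  exact: measureU.
rewrite IH (indep_events dLB eL eB) label_cell// EFinD EFinM.
by rewrite (@unblocked_probability n m v t (euler pmass n m)).
Qed.

End branching.

(** * Offspring laws as mass functions on finitely supported vectors *)

Section offspring_masses.
Context (R : realType) (T : countType) (mu : T -> probability (offspring T) R).
Local Notation fsvec := {fsfun T -> nat with 0%N}.

Lemma negligible_bigcupT d (Omega : measurableType d) (P : probability Omega R)
    (I : countType) (A : I -> set Omega) :
  (forall i, P.-negligible (A i)) -> P.-negligible (\bigcup_i A i).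
Proof.
move=> hA; apply: (@negligibleS _ _ _ _ (\bigcup_n oapp A set0 (@pickle_inv I n))).
  by move=> w [i _ Ai]; exists (choice.pickle i); rewrite ?pickleK_inv.
apply: negligible_bigcup => n; case: (@pickle_inv I n) => [i|] /=; first exact: hA.
exact: negligible_set0.
Qed.

Definition finite_support : set (offspring T) := [set l | finite_set [set j | l j <> 0%N]].

Lemma finite_supportE : finite_support = \bigcup_(l : fsvec) [set (l : T -> nat)].
Proof.
apply/seteqP; split=> [l lfin|_ [l _ ->]].
  exists [fsfun j in fset_set [set j | l j <> 0%N] => l j] => //=.
  apply/funext => j; rewrite fsfunE; case: ifPn => //.
  by rewrite in_fset_set// notin_setE /= => /contrapT ->.
apply: (@sub_finite_set _ _ [set` finsupp l]); last exact: finite_fset.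
by move=> j /= /eqP lj; rewrite mem_finsupp.
Qed.

Lemma measurable_finite_support : measurable finite_support.
Proof.
rewrite finite_supportE; apply: countable_bigcupT_measurable => [|l].
  exact: countableP.
exact: measurable_offspring1.
Qed.

Lemma has_sum_pmass k : {ae mu k, forall l, finite_support l} ->
  has_sum (pmass mu k) 1.
Proof.
have mF := measurable_finite_support.
move=> /(negligibleP (mu k) (measurableC mF)) h0.
have h : (1 - mu k finite_support = 0)%E by rewrite -probability_setC.
have := has_sum_partition (mu k) (fun l : fsvec => measurable_offspring1 l).
rewrite -finite_supportE => H.
rewrite (_ : 1 = fine (mu k finite_support)).
  apply: H => l l' _ _ [w [/= h1 h2]]; apply/fsfunP => j.
  by rewrite -[l j]/((l : T -> nat) j) -h1 h2.
have fm : mu k finite_support \is a fin_num.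
  by rewrite fin_num_measure.
by move: h; rewrite -(fineK fm) -EFinB => -[/eqP]; rewrite subr_eq0 => /eqP <-.
Qed.

Lemma measurable_coordinate j (B : set nat) : measurable [set l : offspring T | B (l j)].
Proof. by apply: sub_gen_smallest; exists j, B. Qed.

Lemma marginal_ge0 k j n : 0 <= marginal mu k j n.
Proof. exact: fine_ge0. Qed.

Lemma has_sum_marginal k j : has_sum (marginal mu k j) 1.
Proof.
have H := has_sum_partition (mu k) (A := fun n => [set l : offspring T | l j = n])
  (fun n => measurable_coordinate j [set n]).
rewrite (_ : 1 = fine (mu k (\bigcup_n [set l : offspring T | l j = n]))).
  by apply: H => m n _ _ [l [/= -> ->]].
rewrite (_ : \bigcup_n _ = setT) ?probability_setT//.
by apply/seteqP; split=> // l _; exists (l j).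
Qed.

(** A cofinal sequence of finite subsets of [T]: continuity from above of a measure works along
    sequences, while [infprod] is a limit along all finite sets. *)
Definition initial_fset n : {fset T} := [fset j in pmap (@pickle_inv T) (iota 0 n)]%fset.

Lemma initial_fset_cvg : initial_fset n @[n --> \oo] --> (totally : set_system {fset T}).
Proof.
move=> S [J _ JS]; exists (\sum_(j <- J) choice.pickle j).+1 => // n /= Jn.
apply: JS => /=; apply/fsubsetP => j jJ; rewrite !inE mem_pmap.
apply/mapP; exists (choice.pickle j); last by rewrite pickleK_inv.
rewrite mem_iota add0n /=; apply: leq_trans Jn.
by rewrite ltnS (big_rem j)//= leq_addr.
Qed.

Hypothesis hsimple : simple mu.

(** The singleton of [l] is the decreasing intersection of the cylinders [C n], whose probabilities
    are finite products by simplicity. *)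
Lemma pmass_infprod k l : pmass mu k l = infprod (fun j => marginal mu k j (l j)).
Proof.
pose C n := \bigcap_(j in [set` initial_fset n]) [set l' : offspring T | l' j = l j].
have mC n : measurable (C n).
  by apply: fin_bigcap_measurable => // j _; exact: (measurable_coordinate j [set l j]).
have PC n : mu k (C n) = (\prod_(j <- initial_fset n) marginal mu k j (l j))%:E.
  rewrite /C hsimple -?prodEFin.
    apply: eq_bigr => j _; rewrite /marginal fineK// fin_num_measure//.
    exact: (measurable_coordinate j [set l j]).
  by move=> j _; exists [set l j] => //; rewrite setTI.
have CE : \bigcap_n C n = [set (l : T -> nat)].
  apply/seteqP; split=> [l' h|_ -> n _ j _ //]; apply/funext => j.
  apply: (h (choice.pickle j).+1) => //=; rewrite !inE mem_pmap.
  apply/mapP; exists (choice.pickle j); last by rewrite pickleK_inv.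
  by rewrite mem_iota add0n /=.
have := nonincreasing_cvg_mu (mu := mu k) (F := C).
rewrite CE => /(_ _ mC (measurable_offspring1 l)) h1.
have {h1} : (fun n => (\prod_(j <- initial_fset n) marginal mu k j (l j))%:E) @ \oo -->
    mu k [set (l : T -> nat)].
  under eq_fun do rewrite -PC; apply: h1.
    by rewrite (le_lt_trans (probability_le1 _ (mC _)))// ltry.
  move=> m n mn; apply/subsetPset => l' hl j /= jn; apply: hl => /=; move: jn.
  rewrite !inE !mem_pmap => /mapP[i]; rewrite mem_iota add0n /= => im ->.
  by apply/mapP; exists i => //; rewrite mem_iota add0n /= (leq_trans im).
have : mu k [set (l : T -> nat)] = (pmass mu k l)%:E.
  by rewrite /pmass fineK// fin_num_measure//; exact: measurable_offspring1.
move=> -> /fine_cvg h; apply/esym.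
have h2 : (fun J => \prod_(j <- J) marginal mu k j (l j)) @ totally -->
    infprod (fun j => marginal mu k j (l j)).
  apply: infprod_cvg => j; rewrite marginal_ge0 /=.
  by have := has_sum_ub [fset l j]%fset (has_sum_marginal k j); rewrite big_seq_fset1.
have h3 := cvg_comp _ _ initial_fset_cvg h2.
by apply: (cvg_unique _ h3 h).
Qed.

End offspring_masses.

(** * Occurrence of types, the root, and almost sure properties of the labels *)

Section branching.
Context d (Omega : measurableType d) (R : realType) (P : probability Omega R)
  (T : countType) (mudot : T -> R) (mu : T -> probability (offspring T) R)
  (tau : Omega -> T) (xi : node T -> T -> {mfun Omega >-> offspring T})
  (sigma : node T -> {RV P >-> R}).
Hypotheses (hU : branching_process P tau xi mudot mu)
  (hsigma : random_labelling tau xi sigma).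

Local Notation events := (events (var_events tau xi sigma)).
Local Notation eventsW := (eventsW hU).

(** A generous set of variables deciding whether [v] is in the tree and with which type: the root
    type and all vectors at smaller depth. The vector of [v] itself is left out. *)
Definition ancestors (v : node T) : set (option (node T * T) + node T) := fun x =>
  match x with
  | inl None => True
  | inl (Some (u, _)) => (size u < size v)%N
  | inr u => False
  end.

Lemma root_type_event v (k : T) : events (ancestors v) (tau @^-1` [set k]).
Proof.
by apply: (events_gen (i := inl None)) => //; exists [set k] => //; rewrite setTI.
Qed.

Lemma in_tree_event v t :
  events (ancestors v) [set w | in_tree t (fun u k => xi u k w) v].
Proof.
elim: v => [|[j i] v IH] /=.
  rewrite (_ : [set _ | _] = setT); first exact: (@measurableT _ (g_sigma_algebraType _)).
  by apply/seteqP; split.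
rewrite (_ : [set _ | _] = [set w | in_tree t (fun u k => xi u k w) v] `&`
    [set w | (i < xi v (node_type t v) w j)%N]); last first.
  by apply/seteqP; split=> w /= => [/andP//|[-> ->]].
apply: (@measurableI _ (g_sigma_algebraType _)).
  by apply: sub_events IH => -[[[u k]|]|u] //=; exact: ltnW.
apply: (sub_events (K := [set inl (Some (v, node_type t v))])) => [_ ->|]; first exact: ltnSn.
exact: (offspring_event j (fun m => i < m)%N).
Qed.

Definition occurs (v : node T) (k : T) : set Omega :=
  [set w | U tau xi w v /\ node_type (tau w) v = k].

Lemma occurs_event v k : events (ancestors v) (occurs v k).
Proof.
rewrite (_ : occurs v k = \bigcup_t (tau @^-1` [set t] `&`
    ([set w | in_tree t (fun u k => xi u k w) v] `&` [set w | node_type t v = k]))).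
  apply: (@countable_bigcupT_measurable _ (g_sigma_algebraType _)) => [|t].
    exact: countableP.
  apply: (@measurableI _ (g_sigma_algebraType _)); first exact: root_type_event.
  apply: (@measurableI _ (g_sigma_algebraType _)); first exact: in_tree_event.
  have [h|h] := pselect (node_type t v = k).
    rewrite (_ : [set _ | _] = setT); first exact: (@measurableT _ (g_sigma_algebraType _)).
    by apply/seteqP; split.
  rewrite (_ : [set _ | _] = set0); first exact: (@measurable0 _ (g_sigma_algebraType _)).
  by apply/seteqP; split.
apply/seteqP; split=> [w [Uw kw]|w [t _ [/= <- []]]]; last by split.
by exists (tau w).
Qed.

Arguments occurs_event : clear implicits.
Arguments root_type_event : clear implicits.

(** If the law of type [k] charged infinitely supported vectors, then, the vector at [v] being
    independent of the occurrence of [k] at [v], local finiteness would give every such occurrence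
    probability 0. So [k] would never occur, and the assumption on such types would apply. *)
Lemma offspring_finite_support : as_locally_finite P tau xi ->
  (forall k, never_occurs P tau xi k ->
     {ae mu k, forall l : offspring T, finite_set [set j | l j <> 0%N]}) ->
  forall k, {ae mu k, forall l, finite_support l}.
Proof.
move=> hfinite hunused k; apply: contrapT => hk.
have {}hunused h := hk (hunused k h).
apply: hunused.
apply: (@negligibleS _ _ _ _ (\bigcup_v occurs v k)).
  move=> w /= /existsNP[v /not_implyP[Uv /contrapT vk]]; by exists v.
apply: negligible_bigcupT => v; apply/(negligibleP P).
  exact: eventsW (occurs_event v k).
pose N := xi v k @^-1` (~` @finite_support T).
have eN : events [set inl (Some (v, k))] N.
  apply: (events_gen (i := inl (Some (v, k)))) => //=.
  exists (~` @finite_support T); last by rewrite setTI.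
  exact: measurableC (@measurable_finite_support T).
have eO := occurs_event v k.
have mO := eventsW eO; have mN := eventsW eN.
have PON : P (occurs v k `&` N) = 0%E.
  apply/(negligibleP P); first exact: measurableI.
  (* Each nonzero coordinate [j] yields the neighbour [(j, 0) :: v], so finitely many neighbours
     leave finitely many such [j]. *)
  apply: negligibleS hfinite => w [[Uv vk] Nw] lf; apply: Nw.
  have /= := lf v Uv; move=> /(finite_image (node_type k)) h.
  apply: sub_finite_set h => j /= lj; exists ((j, 0%N) :: v) => //; split.
    by rewrite /U /= vk; apply/andP; split=> //; rewrite lt0n; apply/eqP.
  by rewrite /tree_adj /= eqxx.
have OE : ancestors v `&` [set inl (Some (v, k))] = set0.
  apply/seteqP; split => // x [xa xe]; move: xa; rewrite xe /=.
  by rewrite ltnn.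
move: PON; rewrite (indep_events hU hsigma OE eO eN) => /eqP.
rewrite mule_eq0 => /orP[/eqP //|/eqP PN]; exfalso; apply: hk.
apply/(negligibleP (mu k)); first exact: measurableC (@measurable_finite_support T).
have mF := measurableC (@measurable_finite_support T).
exact: etrans (esym (offspring_law hU v k mF)) PN.
Qed.

Lemma root_law_ge0 k : 0 <= mudot k.
Proof. by rewrite -lee_fin -(root_law hU). Qed.

Lemma has_sum_root_law : has_sum mudot 1.
Proof.
have := has_sum_partition P (root_measurable hU).
have -> : (fun k => fine (P (tau @^-1` [set k]))) = mudot.
  by apply/funext => k; rewrite (congr1 fine (root_law hU k)).
rewrite (_ : \bigcup_k _ = setT) ?probability_setT.
  by apply; move=> k k' _ _ [w [/= -> ->]].
by apply/seteqP; split=> // w _; exists (tau w).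
Qed.

Definition root_selected n : set Omega :=
  [set w | selected xi sigma n n.+1 [::] (tau w) w].

Lemma root_selectedE n : root_selected n =
  \bigcup_k (tau @^-1` [set k] `&` selected xi sigma n n.+1 [::] k).
Proof.
by apply/seteqP; split=> [w h|w [k _ [/= <-]]]; first by exists (tau w).
Qed.

Lemma measurable_root_selected n : measurable (root_selected n).
Proof.
rewrite root_selectedE; apply: countable_bigcupT_measurable => [|k].
  exact: countableP.
apply: measurableI; first exact: (root_measurable hU).
exact: (eventsW (selected_events n n.+1 k)).
Qed.

Lemma has_sum_root_selected n : (forall k, has_sum (pmass mu k) 1) ->
  has_sum (fun k => mudot k * euler (pmass mu) n n.+1 k) (fine (P (root_selected n))).
Proof.
move=> hfin.
have mS k : measurable (tau @^-1` [set k] `&` selected xi sigma n n.+1 [::] k).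
  apply: measurableI; first exact: (root_measurable hU).
  exact: (eventsW (selected_events n n.+1 k)).
have := has_sum_partition P mS; rewrite -root_selectedE.
have -> : (fun k => fine (P (tau @^-1` [set k] `&` selected xi sigma n n.+1 [::] k))) =
    (fun k => mudot k * euler (pmass mu) n n.+1 k).
  apply/funext => k; have eT := root_type_event [::] k.
  have d0 : [set inl None] `&` below [::] = set0 :> set (option (node T * T) + node T).
    by apply/seteqP; split=> // _ [-> ].
  have eT' : events [set inl None] (tau @^-1` [set k]).
    by apply: (events_gen (i := inl None)) => //; exists [set k] => //; rewrite setTI.
  rewrite (indep_events hU hsigma d0 eT' (selected_events n n.+1 k)).
  by rewrite (root_law hU) (selected_probability hU hsigma hfin)// -EFinM.
by apply; move=> k k' _ _ [w [[/= -> _] [/= -> _]]].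
Qed.

Lemma measurable_label v (B : set R) : measurable B -> measurable (sigma v @^-1` B).
Proof. by move=> mB; exact: (eventsW (label_event mB)). Qed.

Lemma label_in_unit v : {ae P, forall w, 0 <= sigma v w < 1}.
Proof.
have mI : measurable (sigma v @^-1` `[0, 1[).
  by apply: measurable_label; exact: measurable_itv.
have PI : P (sigma v @^-1` `[0, 1[) = 1%E.
  (* For n = 0 the only cell is [0, 1[ itself. *)
  have := label_cell hsigma v (ltnSn 0); rewrite /cell mul0r divr1 invr1.
  exact.
exists (~` (sigma v @^-1` `[0, 1[)); split; first exact: measurableC.
  by rewrite probability_setC// PI subee.
by move=> w /= h; rewrite in_itv.
Qed.

(** Two independent labels share one of n + 1 cells with probability at most (n + 1) / (n + 1)^2,
    whereas equal labels in [0, 1[ share a cell for every n. *)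
Lemma labels_distinct u v : u != v -> {ae P, forall w, sigma u w <> sigma v w}.
Proof.
move=> uv; pose S n := \bigcup_(m in `I_n.+1) (sigma u @^-1` cell n m `&` sigma v @^-1` cell n m).
have mC x n m : measurable (sigma x @^-1` cell n m).
  by apply: measurable_label; exact: measurable_itv.
have mS n : measurable (S n).
  by apply: fin_bigcup_measurable => [|m _]; [exact: finite_II|exact: measurableI].
have PS n : (P (S n) <= (n.+1%:R^-1)%:E)%E.
  have PC m : (m < n.+1)%N -> P (sigma u @^-1` cell n m `&` sigma v @^-1` cell n m) =
      (n.+1%:R^-1 * n.+1%:R^-1)%:E.
    move=> mn; rewrite EFinM -{1}(label_cell hsigma u mn) -(label_cell hsigma v mn).
    apply: (indep_events hU hsigma (K := [set inr u]) (L := [set inr v])).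
    - by apply/seteqP; split=> // _ [-> [/eqP]]; rewrite (negPf uv).
    - by apply: label_event; exact: measurable_itv.
    - by apply: label_event; exact: measurable_itv.
  rewrite /S bigcup_mkord.
  apply: (@le_trans _ _ (\sum_(m < n.+1) P (sigma u @^-1` cell n m `&` sigma v @^-1` cell n m))%E).
    apply: (Boole_inequality P (A := fun m => sigma u @^-1` cell n m `&` sigma v @^-1` cell n m)).
    by move=> m _; apply: measurableI.
  rewrite (eq_bigr (fun=> (n.+1%:R^-1 * n.+1%:R^-1)%:E)); last by move=> m _; rewrite PC.
  by rewrite sumEFin lee_fin sumr_const card_ord -[leLHS]mulr_natl mulrA mulfV// mul1r.
have Z : P (\bigcap_n S n) = 0%E.
  apply/eqP; rewrite eq_le measure_ge0 andbT.
  apply/lee_addgt0Pr => e e0; rewrite add0e.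
  pose k := Num.trunc e^-1.
  have hn : k.+1%:R^-1 < e by rewrite invf_plt ?posrE// truncnS_gt.
  apply: (@le_trans _ _ (P (S k))).
    apply: le_measure; rewrite ?inE //; first exact: bigcapT_measurable.
    exact: bigcap_inf.
  apply: (le_trans (PS k)); rewrite lee_fin; exact: ltW.
have zneg : P.-negligible (\bigcap_n S n).
  by exists (\bigcap_n S n); split => //; exact: bigcapT_measurable.
apply: negligibleS (negligibleU (label_in_unit u) zneg) => w /= /contrapT e.
have [lu|lu] := boolP (0 <= sigma u w < 1); [right|by left; move/negP: lu].
move=> n _; have lu' : 0 <= sigma u w <= 1 by move: lu => /andP[-> /ltW].
have [_ t1 _] := trunc_itv n lu'.
have lu0 : 0 <= n.+1%:R * sigma u w by case/andP: lu => *; rewrite mulr_ge0.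
have /andP[_ t2] := truncn_itv lu0.
exists (Num.trunc (n.+1%:R * sigma u w)) => /=.
  rewrite truncn_lt_nat//; rewrite gtr_pMr//; by case/andP: lu.
have h : cell n (Num.trunc (n.+1%:R * sigma u w)) (sigma u w).
  by rewrite /cell /= in_itv /= t1 /= ltr_pdivlMr// mulrC.
by split=> //=; rewrite -e.
Qed.

End branching.

(** * Comparison with the greedy set *)

Section greedy.
Context (R : realType) (V : choiceType) (e : rel V).
Implicit Types (s : V -> R) (G : {fset V}).

Let step (I : seq V) v := if has (e v) I then I else v :: I.

Lemma foldl_step_sub L v : v \in foldl step [::] L -> v \in L.
Proof.
elim/last_ind: L v => [//|L x IH] v; rewrite foldl_rcons /step.
case: ifP => _; first by move=> /IH h; rewrite mem_rcons inE h orbT.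
by rewrite inE mem_rcons inE => /orP[->//|/IH ->]; rewrite orbT.
Qed.

(** Induction from the end of the list: the last vertex has the largest label, so it influences no
    earlier decision. *)
Lemma foldl_stepP s L : pairwise (fun u v => s u < s v) L -> forall v, v \in L ->
  (v \in foldl step [::] L) <->
  (forall u, u \in L -> s u < s v -> e v u -> u \notin foldl step [::] L).
Proof.
elim/last_ind: L => [//|L x IH]; rewrite pairwise_rcons => /andP[/allP Lx PL] v.
rewrite foldl_rcons; set I := foldl step [::] L.
have xL : x \notin L by apply/negP => /Lx; rewrite ltxx.
have xI : x \notin I by apply: contra xL; exact: foldl_step_sub.
have memI u : u != x -> (u \in step I x) = (u \in I).
  by rewrite /step; case: ifP => // _ ux; rewrite inE (negPf ux).
have nx u : u \in L -> u != x by move=> uL; apply: contraNneq xL => <-.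
rewrite mem_rcons inE => /orP[/eqP ->|vL]; last first.
  rewrite memI ?nx// (IH PL v vL); split=> h u.
    rewrite mem_rcons inE => /orP[/eqP ->|uL] suv evu.
      by have := lt_trans suv (Lx _ vL); rewrite ltxx.
    by rewrite memI ?nx//; exact: h.
  move=> uL suv evu; rewrite -(memI u) ?nx//; apply: h => //.
  by rewrite mem_rcons inE uL orbT.
rewrite /step; case: ifP => [/hasP[u uI exu]|/negbT /hasPn h]; split.
- by move=> xI'; rewrite xI' in xI.
- have uL := foldl_step_sub uI.
  move=> /(_ u); rewrite mem_rcons inE uL orbT => /(_ isT (Lx _ uL) exu).
  by rewrite uI.
- move=> _ u; rewrite mem_rcons inE => /orP[/eqP ->|uL sux exu].
    by rewrite ltxx.
  by rewrite inE negb_or nx//=; apply/negP => /h; rewrite exu.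
- by rewrite inE eqxx.
Qed.

Lemma greedy_setP s G : {in G &, injective s} -> forall v, v \in G ->
  (v \in greedy_set e s G) <->
  (forall u, u \in G -> s u < s v -> e v u -> u \notin greedy_set e s G).
Proof.
move=> sinj v vG; rewrite /greedy_set.
have memL u : (u \in sort (fun u v => s u <= s v) G) = (u \in G) by rewrite mem_sort.
have hp : pairwise (fun u v => s u < s v) (sort (fun u v => s u <= s v) G).
  have h1 : pairwise (fun u v => s u <= s v) (sort (fun u v => s u <= s v) G).
    rewrite -sorted_pairwise; last by move=> b a c; exact: le_trans.
    by apply: sort_sorted => a b; exact: le_total.
  have h2 : pairwise [rel u v | u != v] (sort (fun u v => s u <= s v) G).
    by rewrite -uniq_pairwise sort_uniq fset_uniq.
  have : pairwise [rel u v | (s u <= s v) && (u != v)] (sort (fun u v => s u <= s v) G).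
    by rewrite pairwise_relI h1 h2.
  apply: (sub_in_pairwise (P := mem G)); last by apply/allP => u; rewrite memL.
  move=> a b aG bG /= /andP[ab nab]; rewrite lt_neqAle ab andbT.
  by apply: contra nab => /eqP /sinj ->.
have := foldl_stepP hp (v := v); rewrite memL => /(_ vG) ->.
by split=> h u; have := h u; rewrite memL.
Qed.

(** The greedy set of a fixed [G] depends on the labels only through finitely many comparisons,
    which makes it measurable in them. *)
Lemma greedy_set_eq s s' G :
  (forall u v, u \in G -> v \in G -> (s u <= s v) = (s' u <= s' v)) ->
  greedy_set e s G = greedy_set e s' G.
Proof.
move=> ss'; rewrite /greedy_set; congr (foldl _ _ _).
(* The two orders agree on [G] only; sorting is pulled back to the finite type [G], where they are
   equal as relations. *)
rewrite enum_fsetE !sort_map.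
have h : (fun u v : G => s (val u) <= s (val v)) = (fun u v => s' (val u) <= s' (val v)).
  by apply/funext => u; apply/funext => v; apply: ss'; exact: valP.
exact: (congr1 (fun r : rel G => [seq val i | i <- [seq x | x <- sort r (Finite.enum G)]]) h).
Qed.

Lemma greedy_set_sub s G v : v \in greedy_set e s G -> v \in G.
Proof. by move=> /foldl_step_sub; rewrite mem_sort. Qed.

End greedy.

Section tree_past.
Context (R : realType) (T : countType) (s : node T -> R) (V : set (node T)).

Lemma past_sub v : past (@tree_adj T) s V [::] v -> V v.
Proof. by move=> [p [_ h <-]]; apply: h; exact: mem_last. Qed.

Lemma past_root : V [::] -> past (@tree_adj T) s V [::] [::].
Proof. by move=> V0; exists [::]; split => // a; rewrite mem_seq1 => /eqP ->. Qed.

Lemma past_cons c v : past (@tree_adj T) s V [::] v -> V (c :: v) ->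
  s (c :: v) < s v -> past (@tree_adj T) s V [::] (c :: v).
Proof.
move=> [p [pp pV lp]] Vc sc; exists (rcons p (c :: v)); split.
- by rewrite rcons_path pp lp /= sc andbT /tree_adj /= eqxx.
- by move=> a; rewrite -rcons_cons mem_rcons inE => /orP[/eqP ->//|/pV].
- by rewrite last_rcons.
Qed.

(* A decreasing path from the root never goes up: it would return to a node
   with a larger label. *)
Lemma past_parent c v : past (@tree_adj T) s V [::] (c :: v) ->
  past (@tree_adj T) s V [::] v /\ s (c :: v) < s v.
Proof.
move=> [p []]; elim/last_ind: p c v => [//|p x IH] c v.
rewrite rcons_path last_rcons => /andP[pp /andP[adj slt]] pV xE.
rewrite {}xE in adj slt pV.
have pV' a : a \in [::] :: p -> V a.
  by move=> ap; apply: pV; rewrite -rcons_cons mem_rcons inE ap orbT.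
move: adj; rewrite /tree_adj => /orP[/= /eqP vE|].
  by rewrite -vE in slt; split=> //; exists p; split.
case pE : (last [::] p) => [//|c' v'] /= /eqP v'E.
have [_] := IH c' v' pp pV' pE; rewrite v'E => h.
by rewrite pE v'E in slt; have := lt_trans slt h; rewrite ltxx.
Qed.

End tree_past.

Section discretization.
Context (R : realType) (V : choiceType) (s : V -> R) (G : {fset V}).

Lemma labels_separated : (forall v, v \in G -> 0 <= s v) ->
  exists N, forall n, (N <= n)%N -> forall u v, u \in G -> v \in G ->
  s u < s v -> exists m, s u < m%:R / n.+1%:R <= s v.
Proof.
move=> s0; pose K u v := Num.trunc (s v - s u)^-1.
(* The sum dominates every [K u v], so the mesh is finer than every gap between labels; the grid
   point just below [s v] then separates. *)
exists (\sum_(u <- G) \sum_(v <- G) K u v)%N => n nN u v uG vG suv.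
have Kn : (K u v <= n)%N.
  by apply: leq_trans nN; rewrite (big_rem u)//= (big_rem v)//= -addnA leq_addr.
have nv0 : 0 <= n.+1%:R * s v by rewrite mulr_ge0// s0.
have /andP[t1 t2] := truncn_itv nv0.
exists (Num.trunc (n.+1%:R * s v)); rewrite ltr_pdivlMr// ler_pdivrMr//.
rewrite [X in _ && (_ <= X)]mulrC t1 andbT.
have gap : 0 < s v - s u by rewrite subr_gt0.
have : (s v - s u)^-1 < n.+1%:R.
  by apply: lt_le_trans (truncnS_gt _) _; rewrite ler_nat ltnS.
rewrite -(ltr_pM2l gap) divff ?gt_eqF// => h.
by move: t2; rewrite -natr1; lra.
Qed.

End discretization.

Section selected_greedy.
Context d (Omega : measurableType d) (R : realType) (P : probability Omega R)
  (T : countType) (tau : Omega -> T)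
  (xi : node T -> T -> {mfun Omega >-> offspring T}) (sigma : node T -> {RV P >-> R}).
Variables (w : Omega) (n : nat) (G : {fset node T}).
Local Notation s := (fun v => sigma v w).
Hypotheses (GE : root_past tau xi sigma w = [set` G])
  (s01 : forall v, 0 <= s v < 1) (sinj : {in G &, injective s})
  (sep : forall u v, u \in G -> v \in G -> s u < s v ->
     exists m, s u < m%:R / n.+1%:R <= s v).

(** Both sides obey the same recursion. In the past only children can block a node, as a parent has
    a larger label; and by [sep] a child in [G] has a smaller label exactly when it lies in a
    strictly smaller cell. *)
Lemma selected_greedy m v : v \in G ->
  selected xi sigma n m v (node_type (tau w) v) w <->
  (s v < m%:R / n.+1%:R) && (v \in greedy_set (@tree_adj T) s G).
Proof.
have inG u : u \in G <-> root_past tau xi sigma w u by rewrite GE.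
elim: m v => [|m IH] v vG.
  by split=> //; rewrite mul0r; case/andP: (s01 v) => h _; rewrite ltNge h.
have n0 : 0 < n.+1%:R^-1 :> R by rewrite invr_gt0.
have [svm|msv] := ltP (s v) (m%:R / n.+1%:R).
  have svm1 : s v < m.+1%:R / n.+1%:R.
    by apply: lt_trans svm _; rewrite ltr_pM2r// ltr_nat.
  have := IH v vG; rewrite svm svm1 /= => <-; split; last by left.
  case=> // -[]; rewrite /cell /= in_itv /= => /andP[h _].
  by have := lt_le_trans svm h; rewrite ltxx.
have [svm1|m1sv] := ltP (s v) (m.+1%:R / n.+1%:R); last first.
  split=> //; move=> /selected_label /= /andP[_ h].
  by have := lt_le_trans h m1sv; rewrite ltxx.
rewrite /= (greedy_setP (@tree_adj T) sinj vG); split.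
  case=> [/selected_label /= /andP[_ h]|[_ h] u uG suv].
    by have := lt_le_trans h msv; rewrite ltxx.
  rewrite /tree_adj => /orP[|]; last first.
    case: v vG msv svm1 h suv => [//|c v] /= vG msv svm1 h suv /eqP vu.
    have /inG /past_parent [_] := vG; rewrite {}vu in suv * => h'.
    by have := lt_trans suv h'; rewrite ltxx.
  case: u uG suv => [//|c u] uG suv /= /eqP uv; rewrite {}uv in uG suv *.
  apply/negP => ug; apply: (h c) => //; split.
    have /inG /past_sub := uG; rewrite /U /=.
    by case: c {uG suv ug} => j i /= /andP[_].
  have := IH _ uG; rewrite (_ : node_type _ (c :: v) = c.1); last by case: c {uG suv ug}.
  move=> ->; rewrite ug andbT.
  (* A grid point separates child from parent, and the parent is in cell [m], so the child lies
     below m / (n + 1). *)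
  have [m' /andP[h1 h2]] := sep uG vG suv; apply: lt_le_trans h1 _.
  rewrite ler_pM2r// ler_nat -ltnS -(ltr_nat R) -(ltr_pM2r n0).
  exact: le_lt_trans h2 svm1.
move=> h; right; split; first by rewrite /cell /= in_itv /= msv.
move=> c _ [/= cxi sel].
(* A selected child has a label below that of [v], hence belongs to the past: the discrete rule
   consults no node outside [G]. *)
have sc : s (c :: v) < s v.
  by have /andP[_ h1] := selected_label sel; exact: lt_le_trans h1 msv.
have cG : (c :: v) \in G.
  apply/inG; apply: past_cons => //; first exact/inG.
  have /inG /past_sub := vG; rewrite /U /=.
  by case: c cxi {sel sc} => j i /= -> ->.
have := IH _ cG; rewrite (_ : node_type _ (c :: v) = c.1); last by case: c {cxi sel sc cG}.
move=> [/(_ sel) /andP[_ cg] _].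
have adj : tree_adj v (c :: v) by rewrite /tree_adj /= eqxx.
by have := h _ cG sc adj; rewrite cg.
Qed.

End selected_greedy.

(** [E] is the union, over countably many outcome lists [b], of the events prescribing these
    outcomes. *)
Lemma measurable_finite_tests d (Omega : measurableType d) (X : Type)
    (test : X -> Omega -> bool) (s : seq X) (E : set Omega) :
  (forall x, measurable [set w | test x w]) ->
  (forall w w', [seq test x w | x <- s] = [seq test x w' | x <- s] -> E w -> E w') ->
  measurable E.
Proof.
move=> mt hE; have mb (b : seq bool) : measurable [set w | [seq test x w | x <- s] = b].
  elim: s {hE} b => [|x s IH] [|b bs] /=.
  - by rewrite (_ : [set _ | _] = setT)//; apply/seteqP; split.
  - by rewrite (_ : [set _ | _] = set0)//; apply/seteqP; split.
  - by rewrite (_ : [set _ | _] = set0)//; apply/seteqP; split.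
  rewrite (_ : [set _ | _] = [set w | test x w = b] `&`
      [set w | [seq test x w | x <- s] = bs]); last first.
    by apply/seteqP; split=> w /= [-> ->].
  apply: measurableI => //; case: b; first exact: mt.
  rewrite (_ : [set _ | _] = ~` [set w | test x w]); first exact: measurableC.
  by apply/seteqP; split=> w /=; case: (test x w) => // h; case: h.
rewrite (_ : E = \bigcup_(b : seq bool) ([set w | [seq test x w | x <- s] = b] `&`
    [set _ | exists2 w', E w' & [seq test x w' | x <- s] = b])).
  apply: countable_bigcupT_measurable => [|b]; first exact: countableP.
  apply: measurableI => //.
  have [h|h] := pselect (exists2 w', E w' & [seq test x w' | x <- s] = b).
    by rewrite (_ : [set _ | _] = setT)//; apply/seteqP; split.
  by rewrite (_ : [set _ | _] = set0)//; apply/seteqP; split.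
apply/seteqP; split=> [w Ew|w [b _ [/= wb [w' Ew' w'b]]]].
  by exists [seq test x w | x <- s] => //; split=> //=; exists w.
by apply: hE Ew'; rewrite w'b.
Qed.

(** The unions [B N] of the symmetric differences [D n] over n >= N decrease to a null set, and
    [P (B N)] bounds the difference of the probabilities at [N]. *)
Lemma probability_cvg_ae d (Omega : measurableType d) (R : realType)
    (P : probability Omega R) (A : nat -> set Omega) (E : set Omega) :
  (forall n, measurable (A n)) -> measurable E ->
  {ae P, forall w, \forall n \near \oo, A n w <-> E w} ->
  fine (P (A n)) @[n --> \oo] --> fine (P E).
Proof.
move=> mA mE hAE.
pose D n := (A n `\` E) `|` (E `\` A n).
pose B N := \bigcup_(n in [set n | (N <= n)%N]) D n.
have mD n : measurable (D n) by apply: measurableU; exact: measurableD.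
have mB N : measurable (B N) by exact: bigcup_measurable.
have mB' : measurable (\bigcap_N B N) by exact: bigcapT_measurable.
have B0 : P (\bigcap_N B N) = 0%E.
  apply/(negligibleP P) => //; apply: negligibleS hAE => w h [N _ hN].
  have [n /= Nn] := h N Logic.I.
  have := hN n Nn; by move=> hn [[a b]|[a b]]; apply: b; apply/hn.
have cB : P (B N) @[N --> \oo] --> 0%E.
  rewrite -B0; apply: nonincreasing_cvg_mu => //.
    by rewrite (le_lt_trans (probability_le1 _ (mB _)))// ltry.
  move=> m n mn; apply/subsetPset => w [i /= ni Di]; exists i => //=.
  exact: leq_trans ni.
have {}cB : fine (P (B N)) @[N --> \oo] --> 0 by exact: fine_cvg cB.
have finP X : measurable X -> P X \is a fin_num by move=> mX; rewrite fin_num_measure.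
have leP X Y N : measurable X -> measurable Y -> X `<=` Y `|` B N ->
    fine (P X) <= fine (P Y) + fine (P (B N)).
  move=> mX mY XY; rewrite -fineD ?finP//; apply: fine_le; rewrite ?fin_numD ?finP//.
  apply: le_trans (measureU2 P mY (mB N)).
  by apply: le_measure; rewrite ?inE//; exact: measurableU.
apply/cvgrPdist_le => e e0; move/cvgrPdist_le : cB => /(_ e e0) cB.
near=> n.
have : `|0 - fine (P (B n))| <= e by near: n.
have BD : D n `<=` B n by move=> w Dw; exists n => /=.
have h1 : fine (P (A n)) <= fine (P E) + fine (P (B n)).
  apply: leP => // w Aw; have [Ew|Ew] := pselect (E w); [by left|right].
  by apply: BD; left.
have h2 : fine (P E) <= fine (P (A n)) + fine (P (B n)).
  apply: leP => // w Ew; have [Aw|Aw] := pselect (A n w); [by left|right].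
  by apply: BD; right.
rewrite !ler_norml; lra.
Unshelve. all: by end_near.
Qed.

(** * Measurability of the greedy event and its approximation *)

Section branching.
Context d (Omega : measurableType d) (R : realType) (P : probability Omega R)
  (T : countType) (mudot : T -> R) (mu : T -> probability (offspring T) R)
  (tau : Omega -> T) (xi : node T -> T -> {mfun Omega >-> offspring T})
  (sigma : node T -> {RV P >-> R}).
Hypotheses (hU : branching_process P tau xi mudot mu)
  (hsigma : random_labelling tau xi sigma).

Local Notation eventsW := (eventsW (sigma := sigma) hU).

Lemma measurable_in_tree v : measurable [set w | U tau xi w v].
Proof.
rewrite (_ : [set _ | _] = \bigcup_k occurs tau xi v k).
  apply: countable_bigcupT_measurable => [|k]; first exact: countableP.
  exact: eventsW (@occurs_event _ _ _ P _ tau xi sigma v k).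
apply/seteqP; split=> [w Uw|w [k _ []//]].
by exists (node_type (tau w) v).
Qed.

Lemma measurable_label_lt u v : measurable [set w | sigma u w < sigma v w].
Proof.
rewrite (_ : [set _ | _] = (fun w => sigma u w < sigma v w) @^-1` [set true]).
  rewrite -[X in measurable X]setTI.
  by apply: measurable_fun_ltr.
by apply/seteqP; split.
Qed.

Lemma measurable_label_le u v : measurable [set w | sigma u w <= sigma v w].
Proof.
rewrite (_ : [set _ | _] = ~` [set w | sigma v w < sigma u w]).
  apply: measurableC; exact: measurable_label_lt.
by apply/seteqP; split=> w /=; rewrite leNgt => /negP.
Qed.

Lemma measurable_root_past v : measurable [set w | root_past tau xi sigma w v].
Proof.
have mp (r : node T) (p : seq (node T)) : measurable [set w |
    path (fun a b => tree_adj a b && (sigma b w < sigma a w)) r p].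
  elim: p r => [|a p IH] r /=.
    by rewrite (_ : [set _ | _] = setT)//; apply/seteqP; split.
  rewrite (_ : [set _ | _] = [set _ | tree_adj r a] `&` [set w | sigma a w < sigma r w]
     `&` [set w | path (fun a b => tree_adj a b && (sigma b w < sigma a w)) a p]).
    apply: measurableI => //; apply: measurableI; last exact: measurable_label_lt.
    case: (tree_adj r a); first by rewrite (_ : [set _ | _] = setT)//; apply/seteqP; split.
    by rewrite (_ : [set _ | _] = set0)//; apply/seteqP; split.
  by apply/seteqP; split=> w /= => [/andP[/andP[-> ->] ->]//|[[-> ->] ->]].
rewrite (_ : [set _ | _] = \bigcup_(p : seq (node T)) (
    [set w | path (fun a b => tree_adj a b && (sigma b w < sigma a w)) [::] p] `&`
    \bigcap_(a in [set` [::] :: p]) [set w | U tau xi w a] `&`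
    [set _ | last [::] p = v])).
  apply: countable_bigcupT_measurable => [|p]; first exact: countableP.
  apply: measurableI; last first.
    have [h|h] := pselect (last [::] p = v).
      by rewrite (_ : [set _ | _] = setT)//; apply/seteqP; split.
    by rewrite (_ : [set _ | _] = set0)//; apply/seteqP; split.
  apply: measurableI => //; apply: fin_bigcap_measurable => // a _.
  exact: measurable_in_tree.
apply/seteqP; split=> [w [p [h1 h2 h3]]|w [p _ [[h1 h2] h3]]]; exists p => //.
Qed.

Definition iota_event : set Omega :=
  [set w | [::] \in greedy_set (@tree_adj T) (fun v => sigma v w)
                      (fset_set (root_past tau xi sigma w))].

(** Split over the countably many finite values [G] of the past. An infinite past contributes
    nothing, since [fset_set] is then empty and the root is not selected. *)
Lemma measurable_iota_event : measurable iota_event.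
Proof.
rewrite (_ : iota_event = \bigcup_(G : {fset node T}) (
    \bigcap_v [set w | root_past tau xi sigma w v <-> v \in G] `&`
    [set w | [::] \in greedy_set (@tree_adj T) (fun v => sigma v w) G])).
  apply: countable_bigcupT_measurable => [|G]; first exact: countableP.
  apply: measurableI.
    apply: countable_bigcapT_measurable => v.
    have [vG|vG] := boolP (v \in G).
      rewrite (_ : [set _ | _] = [set w | root_past tau xi sigma w v]).
        exact: measurable_root_past.
      by apply/seteqP; split=> w /= => [[_ h]|h]; [exact: h|split].
    rewrite (_ : [set _ | _] = ~` [set w | root_past tau xi sigma w v]).
      exact: measurableC (measurable_root_past v).
    apply/seteqP; split=> w /= => [[h _] a|h]; first by have := h a.
    by split.
  apply: (@measurable_finite_tests _ _ _ (fun uv w => sigma uv.1 w <= sigma uv.2 w)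
    [seq (u, v) | u <- G, v <- G]); first by move=> uv; exact: measurable_label_le.
  move=> w w' h /=; rewrite (@greedy_set_eq _ _ _ _ (fun v => sigma v w')) => //.
  move=> u v uG vG; have uvG : (u, v) \in [seq (u, v) | u <- G, v <- G].
    by apply/allpairsP; exists (u, v).
  by have /eq_in_map /(_ _ uvG) := h.
apply/seteqP; split=> [w|w [G _ [h]]].
  rewrite /iota_event /= => h.
  have [fin|inf] := pselect (finite_set (root_past tau xi sigma w)).
    exists (fset_set (root_past tau xi sigma w)) => //; split=> // v _ /=.
    by rewrite in_fset_set// in_setE.
  by have := greedy_set_sub h; rewrite /fset_set; case: pselect.
rewrite /iota_event /= (_ : root_past _ _ _ _ = [set` G]) ?set_fsetK//.
by apply/seteqP; split=> v /=; apply h.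
Qed.

Lemma root_selected_eventually : nonexplosive tau xi sigma ->
  {ae P, forall w, \forall n \near \oo, root_selected tau xi sigma n w <-> iota_event w}.
Proof.
move=> hne.
have h1 : P.-negligible (\bigcup_v ~` [set w | 0 <= sigma v w < 1]).
  by apply: negligible_bigcupT => v; exact: (label_in_unit hU hsigma v).
have h2 : P.-negligible (\bigcup_(uv : node T * node T)
    ~` [set w | uv.1 != uv.2 -> sigma uv.1 w <> sigma uv.2 w]).
  apply: negligible_bigcupT => -[u v] /=.
  have [<-|uv] := eqVneq u v.
    rewrite (_ : ~` _ = set0); first exact: negligible_set0.
    by apply/seteqP; split=> // w /=; apply.
  apply: negligibleS (labels_distinct hU hsigma uv) => w /= h h'.
  by apply: h => _.
apply: negligibleS (negligibleU hne (negligibleU h1 h2)) => w /= hw.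
apply: contrapT => /not_orP[/contrapT fin /not_orP[l1 l2]]; apply: hw.
have s01 v : 0 <= sigma v w < 1 by apply: contrapT => h; apply: l1; exists v.
have sinj u v : sigma u w = sigma v w -> u = v.
  move=> h; apply/eqP; apply: contrapT => uv; apply: l2; exists (u, v) => //=.
  by move=> h'; apply: h' h; exact/negP.
have GE : root_past tau xi sigma w = [set` fset_set (root_past tau xi sigma w)].
  by rewrite fset_setK.
have sinjG : {in fset_set (root_past tau xi sigma w) &, injective (fun v => sigma v w)}.
  by move=> u v _ _; exact: sinj.
have [|N hN] := @labels_separated R _ (fun v => sigma v w) (fset_set (root_past tau xi sigma w)).
  by move=> v _; case/andP: (s01 v).
exists N => // n /= Nn.
have r0 : [::] \in fset_set (root_past tau xi sigma w).
  by rewrite in_fset_set// inE; apply: past_root.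
have := selected_greedy GE s01 sinjG (hN n Nn) n.+1 r0.
(* For m = n + 1 the condition on the label of the root is that it be below 1, which [s01]
   provides. *)
rewrite divff// => h; rewrite /root_selected /iota_event /=.
by case/andP: (s01 [::]) => _ s1; move: h; rewrite s1.
Qed.

End branching.

Theorem theorem1p3 (d : measure_display) (Omega : measurableType d)
    (R : realType) (P : probability Omega R) (T : countType)
    (mudot : T -> R) (mu : T -> probability (offspring T) R)
    (tau : Omega -> T) (xi : node T -> T -> {mfun Omega >-> offspring T})
    (sigma : node T -> {RV P >-> R})
    (hU : branching_process P tau xi mudot mu)
    (hsimple : simple mu)
    (hsigma : random_labelling tau xi sigma)
    (hfinite : as_locally_finite P tau xi)
    (hnonexplosive : nonexplosive tau xi sigma)
    (hunused : forall k, never_occurs P tau xi k ->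
       {ae mu k, forall l : offspring T, finite_set [set j | l j <> 0%N]}) :
  exists y : T -> R -> R,
    ode_solution mu y /\
    iota_root tau xi sigma = \esum_(k in [set: T]) (y k 1 * mudot k)%:E.
Proof.
have hfin k : has_sum (pmass mu k) 1.
  by apply: has_sum_pmass; exact: (offspring_finite_support hU hsigma hfinite hunused).
have q0 k l : 0 <= pmass mu k l by exact: pmass_ge0.
have [G [y [GP ooG hy]]] := polygon_limit q0 hfin.
have bnd s t k := @polygon_limit_bounds _ _ _ q0 hfin G y s t k GP ooG hy.
have y01 k x : 0 <= x <= 1 -> 0 <= y k x <= 1.
  by move=> /andP[x0 x1]; have [] := bnd x x k x0 (lexx x) x1.
have y0 k : y k 0 = 0.
  have h : polygon (pmass mu) n k 0 @[n --> G] --> y k 0 by apply: hy; rewrite lexx ler01.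
  suff h0 : polygon (pmass mu) n k 0 @[n --> G] --> (0 : R) by apply: (cvg_unique _ h h0).
  rewrite (_ : (fun n => polygon (pmass mu) n k 0) = fun=> 0); first exact: cvg_cst.
  by apply/funext => n; rewrite /polygon mulr0 truncn0.
(* The bounds from [s = 0], with slope at most 1; this puts [1 - y j x / x] in [0, 1]. *)
have yx k x : 0 <= x <= 1 -> 0 <= y k x <= x.
  move=> x01; have /andP[-> _] := y01 k x x01; case/andP: x01 => x0 x1.
  have [_ _] := bnd 0 x k (lexx 0) x0 x1; rewrite y0 !subr0 => /le_trans; apply.
  have /andP[_ g1] : 0 <= gen (pmass mu k) (y^~ 0) <= 1.
    by apply: gen_itv => // j; rewrite y0 lexx ler01.
  by rewrite ler_piMr.
exists y; split; first split=> // k x x01.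
  exists (gen (pmass mu k) (y ^~ x)).
    by apply: (derivative_of_bounds q0 hfin) => // s t k' *; exact: bnd.
  apply: has_sum_partial_sum => [l|]; last first.
    apply: (has_sum_ode_term (q0 k) (hfin k) (p := marginal mu k)) => //.
    - by move=> j n; exact: marginal_ge0.
    - by move=> j; exact: has_sum_marginal.
    - by move=> l; exact: pmass_infprod.
    - by move=> j; exact: yx.
  have m0 j n : 0 <= marginal mu k j n by exact: marginal_ge0.
  have m1 j : has_sum (marginal mu k j) 1 by exact: has_sum_marginal.
  suff /andP[] : 0 <= ode_term mu y k x l <= 1 by [].
  apply: infprod_itv => j.
  have /andP[z0 z1] : 0 <= 1 - y j x / x <= 1.
    have [->|xN0] := eqVneq x 0; first by rewrite invr0 mulr0 subr0 ler01 lexx.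
    have xp : 0 < x by rewrite lt_neqAle eq_sym xN0; case/andP: x01.
    have /andP[h1 h2] := yx j x x01.
    have : y j x / x <= 1 by rewrite ler_pdivrMr// mul1r.
    have : 0 <= y j x / x by rewrite divr_ge0// ltW.
    by lra.
  rewrite mulr_ge0 ?exprn_ge0 ?(thinning_ge0 (m0 j) (m1 j))//=.
  by rewrite mulr_ile1 ?exprn_ge0 ?exprn_ile1 ?(thinning_ge0 (m0 j) (m1 j))
    ?(thinning_le (m0 j) (m1 j)).
have mE := measurable_iota_event sigma hU.
have hP : fine (P (root_selected tau xi sigma n)) @[n --> G] -->
    fine (P (iota_event tau xi sigma)).
  (* Convergence along [\oo] passes to the finer filter [G], along which the Euler values
     converge. *)
  apply: cvg_trans (cvg_app _ ooG) _; apply: probability_cvg_ae => //.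
  - by move=> n; exact: (measurable_root_selected sigma hU).
  - exact: (root_selected_eventually hU hsigma hnonexplosive).
have y1 k : 0 <= y k 1 <= 1 by apply: y01; rewrite ler01 lexx.
have hS : has_sum (fun k => mudot k * y k 1)
    (fine (\esum_(k in [set: T]) (mudot k * y k 1)%:E)).
  apply: (@has_sum_bounded _ _ _ 1) => [k|X].
    by rewrite mulr_ge0 ?(root_law_ge0 hU)//; case/andP: (y1 k).
  apply: le_trans (has_sum_ub X (has_sum_root_law hU)); apply: ler_sum => k _.
  by rewrite ler_piMr ?(root_law_ge0 hU)//; case/andP: (y1 k).
(* At x = 1 the step function is the last iterate, m = n + 1, so its average under the root law is
   the probability of [root_selected]. *)
have hP' : fine (P (root_selected tau xi sigma n)) @[n --> G] -->
    fine (\esum_(k in [set: T]) (mudot k * y k 1)%:E).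
  apply: (has_sum_cvg (root_law_ge0 hU) (has_sum_root_law hU)
    (u := fun n k => polygon (pmass mu) n k 1) _ y1 _ _ hS).
  - apply: nearW => n k; apply: euler_itv => //.
    by rewrite mulr1 natrK.
  - by move=> k; apply: hy; rewrite ler01 lexx.
  - apply: nearW => n; have := has_sum_root_selected hU hsigma n hfin.
    by rewrite /polygon mulr1 natrK.
have PE : fine (P (iota_event tau xi sigma)) =
    fine (\esum_(k in [set: T]) (mudot k * y k 1)%:E) by exact: (cvg_unique _ hP hP').
have -> : iota_root tau xi sigma = P (iota_event tau xi sigma) by [].
rewrite -[LHS]fineK ?fin_num_measure// PE -hS.
by apply: eq_esum => k _; rewrite mulrC.
Qed.
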